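(* Let $A_1,\dots,A_5\in\mathbb R$ and let $(\rho,\mathbf u,p)$ be a solution, with $\mathbf f=0$, of the viscously regularized incompressible variable density system $$\partial_t\rho+\mathbf u\cdot\nabla\rho=\nabla\cdot\mathbf f_\rho,$$ $$\partial_t\mathbf m+\mathbf u\cdot\nabla\mathbf m+\nabla p=\mathbf f+\nabla\cdot\big(\mu(\nabla\mathbf u+(\nabla\mathbf u)^\top)\big)+\mathbf f_{\mathbf m},$$ $$\nabla\cdot\mathbf u=0,$$ in $\Omega\times(0,T]$, with initial data $\mathbf u(\mathbf x,0)=\mathbf u_0(\mathbf x)$, $\rho(\mathbf x,0)=\rho_0(\mathbf x)$, where $\mathbf m=\rho\mathbf u$, $\mathbf f_\rho=\kappa\nabla\rho$ and $$\mathbf f_{\mathbf m}=A_1(\nabla\mathbf f_\rho)\mathbf u+A_2(\nabla\mathbf f_\rho)^\top\mathbf u+A_3(\nabla\mathbf u)\mathbf f_\rho+A_4(\nabla\mathbf u)^\top\mathbf f_\rho+A_5(\nabla\cdot\mathbf f_\rho)\mathbf u .$$ Then the system: 1. dissipates kinetic energy, i.e. $\partial_t\,\tfrac12\int_\Omega\rho\,\mathbf u\cdot\mathbf u\,d\mathbf x\le0$, if $A_1+A_2-A_3=0$ and $A_5-\tfrac12A_4=\tfrac12$; 2. conserves momentum, i.e. $\partial_t\int_\Omega\mathbf m\,d\mathbf x=0$, if $A_1-A_3=0$ and $A_5-A_4=0$; 3. conserves angular momentum, i.e. $\partial_t\int_\Omega\mathbf m\times\mathbf x\,d\mathbf x=0$,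 if $A_1-A_3=0$ and $A_5-A_4=0$ and $A_2=A_4$.
   Context: $\Omega\subset\mathbb R^d$ ($d=2,3$) is a bounded domain with periodic boundary conditions. The unknowns are the density $\rho>0$, the velocity $\mathbf u$ and the pressure $p$, and $\nabla\cdot\mathbf u=0$ holds pointwise. The dynamic viscosity $\mu\ge0$ and the mass diffusivity $\kappa\ge0$ may depend on space. $\mathbf f$ is an external force. Convention: $(\nabla\mathbf u)_{ij}=\partial_{x_i}u_j$ for a vector field $\mathbf u$, so $((\nabla\mathbf u)\mathbf w)_i=\sum_j(\partial_{x_i}u_j)w_j$ and $((\nabla\mathbf v)^\top\mathbf u)_j=\sum_i u_i\partial_{x_i}v_j=(\mathbf u\cdot\nabla\mathbf v)_j$. The divergence of a matrix field $B$ is $(\nabla\cdot B)_j=\sum_i\partial_{x_i}B_{ij}$. In 2D, vectors are extended by a zero last component in cross products.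
   Formalization: Item 3 fails for general periodic solutions, as x is not periodic (ρ=1, κ=μ=0, p=0, u=(sin(y−ct),c)); it is proved assuming that on each face of the period box with normal e_i: u_i=0, (f_ρ)_i u=0 and μ(∇u+(∇u)^T)_ij=0 for j≠i. *)

(* Defs.v *)
From HB Require Import structures.
From mathcomp Require Import all_boot all_order all_algebra.
From mathcomp Require Import all_classical all_reals all_analysis.

Set Implicit Arguments.
Unset Strict Implicit.
Unset Printing Implicit Defensive.

Import Order.TTheory GRing.Theory Num.Theory.
Import numFieldNormedType.Exports.

Local Open Scope classical_set_scope.
Local Open Scope ring_scope.

Section Geometry.
Context {R : realType} {d : nat}.
Implicit Types (a b x : 'rV[R]_d) (i : 'I_d).

Definition basis_vec i : 'rV[R]_d := delta_mx 0 i.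

Definition box a b : set 'rV[R]_d :=
  [set x | forall i, a 0 i < x 0 i < b 0 i].

(* the two opposite faces of the closed box with normal [basis_vec i] *)
Definition faces a b i : set 'rV[R]_d :=
  [set x | (forall j, a 0 j <= x 0 j <= b 0 j) /\
           (x 0 i = a 0 i \/ x 0 i = b 0 i)].

(* Periodic boundary conditions on [box a b]: the field is defined on all of
   R^d and has the box as a period cell. *)
Definition periodic {W : Type} a b (g : 'rV[R]_d -> W) :=
  forall i x, g (x + (b 0 i - a 0 i) *: basis_vec i) = g x.

End Geometry.

Section Calculus.
Context {R : realType} {d : nat}.
Implicit Types (g : 'rV[R]_d -> R) (v w : 'rV[R]_d -> 'rV[R]_d).

Definition pd (i : 'I_d) g (x : 'rV[R]_d) : R := 'D_(basis_vec i) g x.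

Fixpoint Ck (k : nat) g : Prop :=
  continuous g /\
  match k with
  | 0 => True
  | k'.+1 => forall i, (forall x, derivable g x (basis_vec i)) /\
                       Ck k' (pd i g)
  end.

Definition Ckv (k : nat) v := forall i, Ck k (fun x => v x 0 i).

Definition grad g x : 'rV[R]_d := \row_i pd i g x.

(* (gradv v)_ij = d v_j / d x_i; so, vectors being rows,
   [w *m gradv v x] is (w . nabla) v, i.e. (nabla v)^T w. *)
Definition gradv v x : 'M[R]_d := \matrix_(i, j) pd i (fun y => v y 0 j) x.

Definition div v x : R := \sum_i pd i (fun y => v y 0 i) x.

Definition divm (B : 'rV[R]_d -> 'M[R]_d) x : 'rV[R]_d :=
  \row_j \sum_i pd i (fun y => B y i j) x.

(* matrix times (column) vector, for vectors stored as rows *)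
Definition mulmv (B : 'M[R]_d) (w : 'rV[R]_d) : 'rV[R]_d := w *m B^T.

Definition dot (v w : 'rV[R]_d) : R := \sum_i v 0 i * w 0 i.

End Calculus.

Section TimeDerivative.
Context {R : realType} {V : normedModType R}.

(* Derivative at t relative to the interval [0, T]: two-sided inside the
   interval, one-sided at its end points. *)
Definition dt_filter (T : R) (g : R -> V) (t : R) :=
  (fun s => (s - t)^-1 *: (g s - g t)) @ within `[0, T] t^'.

Definition has_dt (T : R) (g : R -> V) (t : R) (l : V) :=
  dt_filter T g t --> l.

Definition dt (T : R) (g : R -> V) (t : R) : V := lim (dt_filter T g t).

Definition dt_derivable (T : R) (g : R -> V) (t : R) :=
  cvg (dt_filter T g t).

End TimeDerivative.

(* Integral over [box a b], as an iterated Lebesgue integral, one coordinate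
   at a time; it is only used on integrands continuous on the closed box. *)
Fixpoint box_int {R : realType} (n : nat) :
    'rV[R]_n -> 'rV[R]_n -> ('rV[R]_n -> R) -> R :=
  match n return 'rV[R]_n -> 'rV[R]_n -> ('rV[R]_n -> R) -> R with
  | 0 => fun _ _ g => g 0
  | n'.+1 => fun a b g =>
      (\int[lebesgue_measure]_(s in `]a ord0 ord0, b ord0 ord0[)
         box_int (@rsubmx R 1 1 n' a) (@rsubmx R 1 1 n' b)
           (fun y => g (row_mx (s%:M : 'M[R]_1) y)))%R
  end.

Section CrossProduct.
Context {R : realType}.

Definition ext3 {d : nat} (v : 'rV[R]_d) : 'rV[R]_3 :=
  \row_k (if insub (val k) is Some i then v 0 (i : 'I_d) else 0).

(* the indices k + 1 and k + 2 are taken modulo 3, in the ring 'I_3 *)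
Definition cross3 (v w : 'rV[R]_3) : 'rV[R]_3 :=
  \row_k (v 0 (k + 1) * w 0 (k + 2) - v 0 (k + 2) * w 0 (k + 1)).

Definition cross {d : nat} (v w : 'rV[R]_d) : 'rV[R]_3 :=
  cross3 (ext3 v) (ext3 w).

End CrossProduct.

Section System.
Context {R : realType} {d : nat}.
Implicit Types (kappa mu : 'rV[R]_d -> R) (a b : 'rV[R]_d).

Definition f_rho kappa (rho : 'rV[R]_d -> R) (x : 'rV[R]_d) : 'rV[R]_d :=
  kappa x *: grad rho x.

Definition f_m (A1 A2 A3 A4 A5 : R) (u frho : 'rV[R]_d -> 'rV[R]_d)
    (x : 'rV[R]_d) : 'rV[R]_d :=
  A1 *: mulmv (gradv frho x) (u x)
  + A2 *: mulmv (gradv frho x)^T (u x)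
  + A3 *: mulmv (gradv u x) (frho x)
  + A4 *: mulmv (gradv u x)^T (frho x)
  + (A5 * div frho x) *: u x.

Definition viscous_stress mu (u : 'rV[R]_d -> 'rV[R]_d) (x : 'rV[R]_d) :
    'M[R]_d :=
  mu x *: (gradv u x + (gradv u x)^T).

Definition momentum (rho : R -> 'rV[R]_d -> R)
    (u : R -> 'rV[R]_d -> 'rV[R]_d) (t : R) (x : 'rV[R]_d) : 'rV[R]_d :=
  rho t x *: u t x.

Definition coefficient a b kappa :=
  [/\ Ck 1 kappa, periodic a b kappa & forall x, 0 <= kappa x].

Record classical (T : R) a b (rho : R -> 'rV[R]_d -> R)
    (u : R -> 'rV[R]_d -> 'rV[R]_d) (p : R -> 'rV[R]_d -> R) : Prop := {
  rho_periodic : forall t : R, t \in `[0, T] -> periodic a b (rho t);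
  u_periodic : forall t : R, t \in `[0, T] -> periodic a b (u t);
  p_periodic : forall t : R, t \in `]0, T] -> periodic a b (p t);
  rho_continuous : {within `[0, T] `*` [set: 'rV[R]_d],
    continuous (fun z : R * 'rV[R]_d => rho z.1 z.2)};
  u_continuous : {within `[0, T] `*` [set: 'rV[R]_d],
    continuous (fun z : R * 'rV[R]_d => u z.1 z.2)};
  rho_dt : forall (t : R) x, t \in `]0, T] -> dt_derivable T (fun s => rho s x : R^o) t;
  u_dt : forall (t : R) x, t \in `]0, T] -> dt_derivable T (fun s => u s x) t;
  rho_dt_continuous : {within `]0, T] `*` [set: 'rV[R]_d],
    continuous (fun z : R * 'rV[R]_d => dt T (fun s => rho s z.2 : R^o) z.1)};
  u_dt_continuous : {within `]0, T] `*` [set: 'rV[R]_d],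
    continuous (fun z : R * 'rV[R]_d => dt T (fun s => u s z.2) z.1)};
  rho_C2 : forall t : R, t \in `]0, T] -> Ck 2 (rho t);
  u_C2 : forall t : R, t \in `]0, T] -> Ckv 2 (u t);
  p_C1 : forall t : R, t \in `]0, T] -> Ck 1 (p t)
}.

Record solution (T : R) a b kappa mu (A1 A2 A3 A4 A5 : R)
    (f : R -> 'rV[R]_d -> 'rV[R]_d)
    (rho0 : 'rV[R]_d -> R) (u0 : 'rV[R]_d -> 'rV[R]_d)
    (rho : R -> 'rV[R]_d -> R) (u : R -> 'rV[R]_d -> 'rV[R]_d)
    (p : R -> 'rV[R]_d -> R) : Prop := {
  sol_classical : classical T a b rho u p;
  sol_rho_gt0 : forall (t : R) x, t \in `[0, T] -> x \in box a b -> 0 < rho t x;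
  sol_mass : forall (t : R) x, t \in `]0, T] -> x \in box a b ->
    dt T (fun s => rho s x : R^o) t + dot (u t x) (grad (rho t) x)
    = div (f_rho kappa (rho t)) x;
  sol_momentum : forall (t : R) x, t \in `]0, T] -> x \in box a b ->
    dt T (fun s => momentum rho u s x) t
    + u t x *m gradv (momentum rho u t) x
    + grad (p t) x
    = f t x + divm (viscous_stress mu (u t)) x
      + f_m A1 A2 A3 A4 A5 (u t) (f_rho kappa (rho t)) x;
  sol_div_free : forall (t : R) x, t \in `]0, T] -> x \in box a b ->
    div (u t) x = 0;
  sol_init_rho : forall x, x \in box a b -> rho 0 x = rho0 x;
  sol_init_u : forall x, x \in box a b -> u 0 x = u0 x
}.

(* Position x is not periodic, so periodicity does not cancel the flux of
   angular momentum through opposite faces: rho = 1, p = 0,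
   u = (sin (y - c t), c) is a periodic Euler flow whose angular momentum over
   a period cell oscillates in time.  Angular momentum is conserved when no
   tangential momentum crosses the faces: none is advected, none is carried by
   the mass diffusion flux, and the viscous traction is normal.  This covers
   fields supported away from the boundary, and impermeable free-slip faces. *)
Definition no_tangential_flux a b kappa mu (rho : 'rV[R]_d -> R)
    (u : 'rV[R]_d -> 'rV[R]_d) :=
  forall i x, x \in faces a b i ->
    [/\ u x 0 i = 0,
        f_rho kappa rho x 0 i *: u x = 0
      & forall j, j != i -> viscous_stress mu u x i j = 0].

Definition kinetic_energy a b (rho : R -> 'rV[R]_d -> R)
    (u : R -> 'rV[R]_d -> 'rV[R]_d) (t : R) : R :=
  2^-1 * box_int a b (fun x => rho t x * dot (u t x) (u t x)).

Definition total_momentum a b (rho : R -> 'rV[R]_d -> R)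
    (u : R -> 'rV[R]_d -> 'rV[R]_d) (t : R) : 'rV[R]_d :=
  \row_j box_int a b (fun x => momentum rho u t x 0 j).

Definition angular_momentum a b (rho : R -> 'rV[R]_d -> R)
    (u : R -> 'rV[R]_d -> 'rV[R]_d) (t : R) : 'rV[R]_3 :=
  \row_k box_int a b (fun x => cross (momentum rho u t x) x 0 k).

End System.

(* Main.v *)
Require Import Defs.
From HB Require Import structures.
From mathcomp Require Import all_boot all_order all_algebra.
From mathcomp Require Import all_classical all_reals all_analysis.
From mathcomp Require Import ring lra.

Set Implicit Arguments.
Unset Strict Implicit.
Unset Printing Implicit Defensive.

Import Order.TTheory GRing.Theory Num.Theory.
Import numFieldNormedType.Exports.

Local Open Scope classical_set_scope.
Local Open Scope ring_scope.

(** The time derivative of each integrand is a divergence plus a remainder.  With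
    [Flux_ij = - u_i m_j - p delta_ij + mu (d_i u_j + d_j u_i)
               + A1 (f . u) delta_ij + A4 f_i u_j + A2 u_i f_j],  [f = f_rho],
    the momentum equation and [div u = 0] give
    [d_t m_j = sum_i d_i Flux_ij + (A3 - A1) (f . d_j u) + (A5 - A4) (div f) u_j].
    Under [A1 = A3] and [A4 = A5] this is a divergence of periodic fields, so its
    integral vanishes.  If moreover [A2 = A4], then [Flux] is symmetric and
    [d_t (m_j x_l - m_l x_j) = sum_i d_i (Flux_ij x_l - Flux_il x_j)]; positions are
    not periodic, and the jump across the faces with normal [e_l] is a multiple of
    [Flux_lj], [j != l], which vanishes there by assumption.  For the energy, the
    mass equation turns [d_t (rho |u|^2 / 2)] into the divergence of
    [sum_j u_j Flux_ij + rho u_i |u|^2 / 2 - A4 f_i |u|^2 / 2] minus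
    [mu / 2 * sum_ij (d_i u_j + d_j u_i)^2].

    Time derivatives pass under the iterated integral because, by the mean value
    theorem and joint continuity, difference quotients converge locally uniformly.
    The same fact in the first space variable, with induction on the dimension for
    the others, reduces the divergence theorem on a box to the fundamental theorem
    of calculus, without Fubini. *)

(** * Convergence of matrices and rows by coordinates *)

Section MatrixTopology.
Context {R : realType}.

(** The matrix uniformity is entrywise, and a filter is stable under finite intersections. *)
Lemma cvg_coord I (F : set_system I) {FF : Filter F} m n
    (f : I -> 'M[R]_(m, n)) (M : 'M[R]_(m, n)) :
  (forall i j, f x i j @[x --> F] --> M i j) -> f @ F --> M.
Proof.
move=> fM; apply/cvg_mx_entourageP => A entA; rewrite near_simpl.
apply: filter_forall => i; apply: filter_forall => j.
have /cvg_entourageP/(_ A entA) := fM i j.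
by rewrite near_simpl; apply: filterS => x; rewrite inE.
Qed.

Lemma cvg_row_mx I (F : set_system I) {FF : Filter F} n
    (f : I -> R) (g : I -> 'rV[R]_n) (s : R) (y : 'rV[R]_n) :
  f @ F --> s -> g @ F --> y ->
  (row_mx ((f x)%:M : 'M[R]_1) (g x) : 'rV[R]_(1 + n)) @[x --> F]
    --> (row_mx (s%:M : 'M[R]_1) y : 'rV[R]_(1 + n)).
Proof.
move=> fs gy; apply: cvg_coord => i j; case: (split_ordP j) => k ->.
  rewrite row_mxEl mxE (_ : (fun x => _) = f); last first.
    by apply/funext => x; rewrite row_mxEl mxE !ord1 eqxx mulr1n.
  by rewrite !ord1 eqxx mulr1n.
rewrite row_mxEr (_ : (fun x => _) = (fun M : 'rV[R]_n => M i k) \o g); last first.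
  by apply/funext => x; rewrite row_mxEr.
by apply: cvg_comp gy _; exact: (@coord_continuous R 1 n i k).
Qed.

End MatrixTopology.

(** * Integrals of continuous functions over an open interval *)

Section IntervalIntegral.
Context {R : realType}.
Notation mu := (@lebesgue_measure R).
Implicit Types (a b : R) (f : R -> R).

Lemma integrable_oo a b f : continuous f ->
  mu.-integrable `]a, b[%classic (EFin \o f).
Proof.
move=> cf; apply: (@integrableS _ _ _ mu `[a, b]%classic) => //.
  by apply: subset_itv; rewrite bnd_simp.
apply: continuous_compact_integrable; first exact: segment_compact.
exact: continuous_subspaceT.
Qed.

(* Convergence along [F], locally uniformly in the integration variable: the
   product filter expresses this, and compactness of [[a, b]] makes it uniform. *)
Lemma itv_int_cvg I (F : set_system I) {FF : Filter F} a b
    (h : I -> R -> R) (h0 : R -> R) :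
  (\forall i \near F, continuous (h i)) -> continuous h0 ->
  (forall s, h z.1 z.2 @[z --> (F, nbhs s)] --> h0 s) ->
  (\int[mu]_(s in `]a, b[) h i s) @[i --> F] --> \int[mu]_(s in `]a, b[) h0 s.
Proof.
move=> ch ch0 hh0; have [ba|ab] := leP b a.
  rewrite set_itv_ge ?bnd_simp -?leNgt//.
  under eq_cvg do rewrite Rintegral_set0.
  by rewrite Rintegral_set0; exact: cvg_cst.
apply/cvgrPdist_le => /= e e0.
pose e' := e / (b - a).
have e'0 : 0 < e' by rewrite divr_gt0// subr_gt0.
have /compact_near_coveringP cov := @segment_compact R a b.
have nearF : \forall i \near F, `[a, b]%classic `<=` [set s | `|h0 s - h i s| <= e'].
  apply: (cov _ _ (fun i s => `|h0 s - h i s| <= e')) => s _.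
  have e2 : 0 < e' / 2 by rewrite divr_gt0.
  have /cvgrPdist_le/(_ _ e2) := hh0 s.
  move=> [[/= U V] [FU sV] UV].
  have /cvgrPdist_le/(_ _ e2) W := ch0 s.
  near=> s' i => /=.
  have -> : h0 s' - h i s' = (h0 s - h i s') - (h0 s - h0 s').
    by ring.
  rewrite (le_trans (ler_normB _ _))// (splitr e') lerD//.
    apply: (UV (i, s')); split => /=.
      by near: i.
    by near: s'.
  by near: s'.
near=> i.
have ci : continuous (h i) by near: i.
rewrite -RintegralB//; try exact: integrable_oo.
have cB : continuous (fun s => h0 s - h i s).
  by move=> s; apply: cvgB; [exact: ch0|exact: ci].
have cN : continuous (fun s => `|h0 s - h i s|).
  by move=> s; apply: cvg_norm; exact: cB.
apply: le_trans; first by apply: le_normr_Rintegral => //; exact: integrable_oo.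
have -> : e = \int[mu]_(s in `]a, b[) (cst e' s).
  by rewrite Rintegral_cst//= lebesgue_measure_itv/= lte_fin ab /= /e' divfK// gt_eqF// subr_gt0.
apply: le_Rintegral => //.
- exact: integrable_oo.
- by apply: integrable_oo => ?; exact: cvg_cst.
- move=> s sab /=; have : `[a, b]%classic `<=` [set s | `|h0 s - h i s| <= e'] by near: i.
  by apply; move: s sab; apply: subset_itv; rewrite bnd_simp.
Unshelve. all: by end_near. Qed.

Lemma itv_int_derive a b f : a < b -> (forall s, derivable f s 1) ->
  continuous (fun s => 'D_1 f s) ->
  \int[mu]_(s in `]a, b[) 'D_1 f s = f b - f a.
Proof.
move=> ab df cdf.
have cf : continuous f.
  by move=> s; apply/differentiable_continuous/derivable1_diffP.
(* End points are null sets, so the integral moves to the closed interval, where the fundamental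
   theorem applies. *)
rewrite Rintegral_itv_bndo_bndc; last exact: integrable_oo.
rewrite Rintegral_itv_obnd_cbnd; last first.
  apply: (@integrableS _ _ _ mu `[a, b]%classic) => //.
    by apply: subset_itv; rewrite bnd_simp.
  apply: continuous_compact_integrable; first exact: segment_compact.
  exact: continuous_subspaceT.
rewrite /Rintegral (continuous_FTC2 ab (F := f))//=.
- exact: continuous_subspaceT.
- split => [s _| |]; first exact: df.
    by apply: cvg_at_right_filter; exact: cf.
  by apply: cvg_at_left_filter; exact: cf.
- by move=> s _; rewrite derive1E.
Qed.

End IntervalIntegral.

(** * Iterated integrals over a box: congruence, limits, linearity *)

Section BoxIntegral.
Context {R : realType}.
Notation mu := (@lebesgue_measure R).

(** The argument built by the recursion of [box_int], retyped as a row of length [n.+1]. *)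
Definition cons_rV n (s : R) (y : 'rV[R]_n) : 'rV[R]_n.+1 :=
  row_mx (s%:M : 'M[R]_1) y.

Lemma cons_rV0 n (s : R) (y : 'rV[R]_n) : cons_rV s y 0 ord0 = s.
Proof.
have -> : ord0 = lshift n (ord0 : 'I_1) by exact: val_inj.
by rewrite [LHS]row_mxEl mxE eqxx mulr1n.
Qed.

Lemma cons_rVS n (s : R) (y : 'rV[R]_n) (i : 'I_n) :
  cons_rV s y 0 (rshift 1 i) = y 0 i.
Proof. exact: row_mxEr. Qed.

Lemma cvg_cons_rV I (F : set_system I) {FF : Filter F} n
    (f : I -> R) (g : I -> 'rV[R]_n) (s : R) (y : 'rV[R]_n) :
  f @ F --> s -> g @ F --> y ->
  (cons_rV (f x) (g x)) @[x --> F] --> cons_rV s y.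
Proof. exact: cvg_row_mx. Qed.

Lemma ord_splitP n (i : 'I_n.+1) :
  i = ord0 \/ exists j : 'I_n, i = rshift 1 j.
Proof.
case: (split_ordP (i : 'I_(1 + n))) => j ->; last by right; exists j.
by left; apply: val_inj; rewrite /= ord1.
Qed.

Lemma box_intS n (a b : 'rV[R]_n.+1) g :
  box_int a b g = \int[mu]_(s in `]a 0 ord0, b 0 ord0[)
    box_int (@rsubmx R 1 1 n a) (@rsubmx R 1 1 n b) (fun y => g (cons_rV s y)).
Proof. by rewrite /= ord1. Qed.

Lemma box_cons n (a b : 'rV[R]_n.+1) (s : R) (y : 'rV[R]_n) :
  s \in `]a 0 ord0, b 0 ord0[ ->
  y \in box (@rsubmx R 1 1 n a) (@rsubmx R 1 1 n b) ->
  cons_rV s y \in box a b.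
Proof.
rewrite in_itv /= => sab /set_mem yab; apply/mem_set => i.
have [->|[j ->]] := ord_splitP i; first by rewrite cons_rV0.
by rewrite cons_rVS; have := yab j; rewrite !mxE.
Qed.

(** The differential equations are assumed only in the open box; this is how they are used under the
    integral sign. *)
Lemma eq_box_int n (a b : 'rV[R]_n) (g h : 'rV[R]_n -> R) : {in box a b, g =1 h} ->
  box_int a b g = box_int a b h.
Proof.
elim: n a b g h => [|n IH] a b g h gh.
  by apply: gh; apply/mem_set => -[].
rewrite !box_intS; apply: eq_Rintegral => s /set_mem sab.
by apply: IH => y yab; apply: gh; apply: box_cons.
Qed.

Lemma box_int_ge0 n (a b : 'rV[R]_n) g : {in box a b, forall x, 0 <= g x} ->
  0 <= box_int a b g.
Proof.
elim: n a b g => [|n IH] a b g g0; first by apply: g0; apply/mem_set => -[].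
rewrite box_intS; apply: Rintegral_ge0 => s sab.
by apply: IH => y yab; apply: g0; apply: box_cons.
Qed.

Lemma continuous_cons_rV n (g : 'rV[R]_n.+1 -> R) (s : R) :
  continuous g -> continuous (fun y => g (cons_rV s y)).
Proof.
move=> cg y; apply: (@cvg_comp _ _ _ (cons_rV s) g); last exact: cg.
by apply: (@cvg_cons_rV _ (nbhs y)); [exact: cvg_cst|exact: cvg_id].
Qed.

Lemma cvg_continuous_cons_rV n (g : 'rV[R]_n.+1 -> R) (s : R) (y : 'rV[R]_n) :
  continuous g -> g (cons_rV z.1 z.2) @[z --> (nbhs s, nbhs y)] --> g (cons_rV s y).
Proof.
move=> cg; apply: (@cvg_comp _ _ _ (fun z => cons_rV z.1 z.2) g); last exact: cg.
by apply: (@cvg_cons_rV _ (nbhs (nbhs s, nbhs y))); [exact: cvg_fst|exact: cvg_snd].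
Qed.

(** Induction on the dimension, for all index types and filters at once: the inner integral is
    treated with index [(i, s)] and filter [F] times [nbhs s], which yields the locally uniform
    convergence in [s] that [itv_int_cvg] requires. *)
Lemma box_int_cvg I (F : set_system I) {FF : Filter F} n (a b : 'rV[R]_n)
    (g : I -> 'rV[R]_n -> R) (g0 : 'rV[R]_n -> R) :
  (\forall i \near F, continuous (g i)) -> continuous g0 ->
  (forall y, g z.1 z.2 @[z --> (F, nbhs y)] --> g0 y) ->
  box_int a b (g i) @[i --> F] --> box_int a b g0.
Proof.
elim: n I F FF a b g g0 => [|n IH] I F FF a b g g0 cg cg0 gg0.
  (* In dimension 0 there is a single point, and the hypothesis at that point is the claim. *)
  apply: (@cvg_comp _ _ _ (fun i => (i, 0)) (fun z => g z.1 z.2)); last exact: gg0.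
  by apply: cvg_pair; [exact: cvg_id|exact: (@cvg_cst 'rV[R]_0)].
(* Continuity of the slice integrals is itself an instance of the induction hypothesis, with [s] as
   the index. *)
have sect g1 : continuous g1 -> continuous (fun s => box_int
    (@rsubmx R 1 1 n a) (@rsubmx R 1 1 n b) (fun y => g1 (cons_rV s y))).
  move=> cg1 s; apply: IH.
  - by near=> s'; exact: continuous_cons_rV.
  - exact: continuous_cons_rV.
  - by move=> y; exact: cvg_continuous_cons_rV.
rewrite box_intS; under eq_cvg do rewrite box_intS.
apply: itv_int_cvg.
- by near=> i; apply: sect; near: i.
- exact: sect.
- move=> s; apply: (IH _ _ _ _ _ (fun z y => g z.1 (cons_rV z.2 y))).
  + have : \forall z \near (F, nbhs s), continuous (g z.1).
      exact: (@cvg_fst _ _ F (nbhs s) _ _ cg).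
    by apply: filterS => z; exact: continuous_cons_rV.
  + exact: continuous_cons_rV.
  + move=> y; apply: (@cvg_comp _ _ _
      (fun z => (z.1.1, cons_rV z.1.2 z.2)) (fun z => g z.1 z.2)); last exact: gg0.
    apply: (@cvg_pair _ _ _ (nbhs (nbhs (F, nbhs s), nbhs y))).
      by apply: (@cvg_comp _ _ _ fst fst _ (nbhs (F, nbhs s))); [exact: cvg_fst|exact: cvg_fst].
    apply: (@cvg_cons_rV _ (nbhs (nbhs (F, nbhs s), nbhs y))); last exact: cvg_snd.
    by apply: (@cvg_comp _ _ _ fst snd _ (nbhs (F, nbhs s))); [exact: cvg_fst|exact: cvg_snd].
Unshelve. all: by end_near. Qed.

Lemma continuous_box_int_cons n (a b : 'rV[R]_n) (g : 'rV[R]_n.+1 -> R) :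
  continuous g -> continuous (fun s => box_int a b (fun y => g (cons_rV s y))).
Proof.
move=> cg s; apply: box_int_cvg.
- by near=> s'; exact: continuous_cons_rV.
- exact: continuous_cons_rV.
- by move=> y; exact: cvg_continuous_cons_rV.
Unshelve. all: by end_near. Qed.

Lemma box_intD n (a b : 'rV[R]_n) (g h : 'rV[R]_n -> R) : continuous g -> continuous h ->
  box_int a b (fun x => g x + h x) = box_int a b g + box_int a b h.
Proof.
elim: n a b g h => [//|n IH] a b g h cg ch; rewrite !box_intS.
rewrite -RintegralD//; last 2 first.
  by apply: integrable_oo; exact: continuous_box_int_cons.
  by apply: integrable_oo; exact: continuous_box_int_cons.
apply: eq_Rintegral => s _.
by apply: IH; exact: continuous_cons_rV.
Qed.

Lemma box_intZ n (a b : 'rV[R]_n) (c : R) (g : 'rV[R]_n -> R) : continuous g ->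
  box_int a b (fun x => c * g x) = c * box_int a b g.
Proof.
elim: n a b g => [//|n IH] a b g cg; rewrite !box_intS.
rewrite -RintegralZl//; last by apply: integrable_oo; exact: continuous_box_int_cons.
apply: eq_Rintegral => s _.
by apply: IH; exact: continuous_cons_rV.
Qed.

Lemma box_intB n (a b : 'rV[R]_n) (g h : 'rV[R]_n -> R) :
  continuous g -> continuous h ->
  box_int a b (fun x => g x - h x) = box_int a b g - box_int a b h.
Proof.
move=> cg ch; have cN : continuous (fun x => -1 * h x).
  by move=> x; apply: (@continuousM _ _ (cst (-1)) h); [exact: cst_continuous|exact: ch].
rewrite -[- box_int a b h]mulN1r -box_intZ// -box_intD//.
by apply: eq_box_int => x _; rewrite mulN1r.
Qed.

Lemma box_int0 n (a b : 'rV[R]_n) : box_int a b (cst 0) = 0.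
Proof.
rewrite -[RHS](mul0r (box_int a b (cst 0))) -box_intZ; last exact: cst_continuous.
by apply: eq_box_int => x _; rewrite mulr0.
Qed.

Lemma continuous_bigsum n I (r : seq I) (g : I -> 'rV[R]_n -> R) :
  (forall i, continuous (g i)) -> continuous (fun x => \sum_(i <- r) g i x).
Proof.
move=> cg; elim: r => [|i r IH].
  by under eq_fun do rewrite big_nil; exact: cst_continuous.
under eq_fun do rewrite big_cons.
by move=> x; apply: (@continuousD _ _ _ (g i)); [exact: cg|exact: IH].
Qed.

Lemma box_int_sum n (a b : 'rV[R]_n) I (r : seq I) (g : I -> 'rV[R]_n -> R) :
  (forall i, continuous (g i)) ->
  box_int a b (fun x => \sum_(i <- r) g i x) = \sum_(i <- r) box_int a b (g i).
Proof.
move=> cg; elim: r => [|i r IH].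
  by under eq_fun do rewrite big_nil; rewrite big_nil; exact: box_int0.
under eq_fun do rewrite big_cons.
by rewrite box_intD ?IH ?big_cons//; exact: continuous_bigsum.
Qed.

End BoxIntegral.

(** * Differentiation under the integral sign *)

Section DerivativeUnderIntegral.
Context {R : realType}.

(* The mean value theorem turns the difference quotient into a value of the
   derivative at an intermediate time, so joint continuity of the derivative
   makes the quotients converge locally uniformly in space. *)
Lemma box_int_quotient_cvg (F : set_system R) {FF : Filter F} (A : set R)
    (t : R) n (a b : 'rV[R]_n) (h h' : R -> 'rV[R]_n -> R) :
  F --> within A (nbhs t) -> (\forall s \near F, s != t) -> A t ->
  (forall s, A s -> continuous (h s)) -> continuous (h' t) ->
  (forall y, h' z.1 z.2 @[z --> (within A (nbhs t), nbhs y)] --> h' t y) ->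
  (forall s y, A s -> s != t -> exists c,
     [/\ A c, `|c - t| <= `|s - t| & h s y - h t y = h' c y * (s - t)]) ->
  (s - t)^-1 *: (box_int a b (h s) - box_int a b (h t)) @[s --> F]
    --> box_int a b (h' t).
Proof.
move=> FA Fneq At ch ch't jh' mvt.
have nA : \forall s \near F, A s.
  by apply: FA; exact: withinT.
pose q s y := (s - t)^-1 * (h s y - h t y).
have cB s : A s -> continuous (fun y => h s y - h t y).
  by move=> As y; apply: (@continuousB _ _ _ (h s) (h t)); [exact: (ch _ As)|exact: (ch _ At)].
have cq s : A s -> continuous (q s).
  move=> As y; apply: (@continuousM _ _ (cst (s - t)^-1) (fun y => h s y - h t y)).
    exact: cst_continuous.
  exact: cB.
have qE : {near F, (fun s => box_int a b (q s)) =1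
    fun s => (s - t)^-1 *: (box_int a b (h s) - box_int a b (h t))}.
  near=> s; have As : A s by near: s.
  rewrite /q box_intZ; last exact: cB.
  by rewrite box_intB//; [exact: (ch _ As)|exact: (ch _ At)].
apply: cvg_trans (near_eq_cvg qE) _.
apply: box_int_cvg => //.
  by near=> s; apply: cq; near: s.
move=> y; apply/cvgrPdist_le => /= e e0.
have /cvgrPdist_le/(_ _ e0) := jh' y.
move=> [[/= U V] [tU yV] UV].
have [/= r r0 rU] : \forall s \near t, A s -> U s by exact: tU.
(* On this set the mean value hypothesis applies, and its intermediate point [c] also stays within
   [r] of [t]. *)
exists ([set s | A s /\ s != t /\ `|s - t| < r], V).
  split => //=.
  near=> s; split; first by near: s.
  split; near: s => //.
  apply: (FA [set s | `|s - t| < r]).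
  exists r => //= s; rewrite /ball/= distrC => st _; exact: st.
move=> [s y'] /= [[As [st str]] Vy'].
have [c [Ac ct hst]] := mvt s y' As st.
rewrite /q hst mulrC mulfK ?subr_eq0//.
apply: (UV (c, y')); split => //=; apply: rU => //=.
by rewrite /ball/= distrC (le_lt_trans ct).
Unshelve. all: by end_near. Qed.

End DerivativeUnderIntegral.

(** * Divergence theorem on a box *)

Section DivergenceTheorem.
Context {R : realType}.
Notation mu := (@lebesgue_measure R).

Lemma cons_rV_shiftS n (s k : R) (y : 'rV[R]_n) (j : 'I_n) :
  k *: basis_vec (rshift 1 j) + cons_rV s y = cons_rV s (k *: basis_vec j + y).
Proof.
apply/rowP => l; rewrite mxE; have [->|[m ->]] := ord_splitP l.
  by rewrite !cons_rV0 !mxE /= mulr0 add0r.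
by rewrite !cons_rVS !mxE.
Qed.

Lemma cons_rV_shift0 n (s k : R) (y : 'rV[R]_n) :
  k *: basis_vec ord0 + cons_rV s y = cons_rV (k + s) y.
Proof.
apply/rowP => l; rewrite mxE; have [->|[m ->]] := ord_splitP l.
  by rewrite !cons_rV0 !mxE /= mulr1.
by rewrite !cons_rVS !mxE /= mulr0 add0r.
Qed.

Lemma is_derive_cons_rV0 n (g : 'rV[R]_n.+1 -> R) (s : R) (y : 'rV[R]_n) :
  derivable g (cons_rV s y) (basis_vec ord0) ->
  is_derive s 1 (fun s => g (cons_rV s y)) (pd ord0 g (cons_rV s y)).
Proof.
rewrite /pd /derivable /derive => dg.
have E : (fun k : R => k^-1 *: (g (cons_rV (k *: 1 + s) y) - g (cons_rV s y))) =
    (fun k => k^-1 *: (g (k *: basis_vec ord0 + cons_rV s y) - g (cons_rV s y))).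
  by apply/funext => k; rewrite cons_rV_shift0 [k *: 1]mulr1.
by split; rewrite /derivable /derive /= E.
Qed.

Lemma pd_cons_rVS n (g : 'rV[R]_n.+1 -> R) (s : R) (j : 'I_n) :
  pd j (fun y => g (cons_rV s y)) = fun y => pd (rshift 1 j) g (cons_rV s y).
Proof.
apply/funext => y; rewrite /pd /derive.
by under eq_fun do rewrite /= -cons_rV_shiftS.
Qed.

Lemma derivable_cons_rVS n (g : 'rV[R]_n.+1 -> R) (s : R) (y : 'rV[R]_n) (j : 'I_n) :
  derivable g (cons_rV s y) (basis_vec (rshift 1 j)) ->
  derivable (fun y => g (cons_rV s y)) y (basis_vec j).
Proof.
rewrite /derivable => dg.
by under eq_fun do rewrite /= -cons_rV_shiftS.
Qed.

(** The quotient lemma is used with the first coordinate in the role of time and [A] the whole line;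
    the mean value theorem along that coordinate supplies the intermediate point. *)
Lemma is_derive_box_int_cons n (a b : 'rV[R]_n) (g : 'rV[R]_n.+1 -> R) (s : R) :
  continuous g -> (forall x, derivable g x (basis_vec ord0)) ->
  continuous (pd ord0 g) ->
  is_derive s 1 (fun s => box_int a b (fun y => g (cons_rV s y)))
    (box_int a b (fun y => pd ord0 g (cons_rV s y))).
Proof.
move=> cg dg cdg.
have mvt (u v : R) y : u < v -> exists2 c, c \in `]u, v[ &
    g (cons_rV v y) - g (cons_rV u y) = pd ord0 g (cons_rV c y) * (v - u).
  move=> uv; apply: (@MVT _ (fun s => g (cons_rV s y))
    (fun s => pd ord0 g (cons_rV s y))) => //.
    by move=> z _; exact: is_derive_cons_rV0.
  apply: continuous_subspaceT => z; apply/differentiable_continuous.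
  by apply/derivable1_diffP; have [] := is_derive_cons_rV0 (dg (cons_rV z y)).
(* Derivatives are limits over increments [k] at 0, whereas the quotient lemma takes points near
   [s]; the image filter under translation by [s] links the two. *)
have Fs : (fun k : R => k *: 1 + s) @ 0^' --> within setT (nbhs s).
  rewrite withinET; apply/cvgrPdist_lt => /= e e0; exists e => //= k /=.
  by rewrite sub0r normrN => ke _; rewrite [k *: 1]mulr1 opprD addrCA subrr addr0 normrN.
have Fneq : \forall u \near (fun k : R => k *: 1 + s) @ 0^', u != s.
  by exists 1 => //= k _ k0 /=; rewrite [k *: 1]mulr1 -subr_eq0 addrK.
have C := @box_int_quotient_cvg R ((fun k : R => k *: 1 + s) @ 0^') _ setT s n a b
  (fun s y => g (cons_rV s y)) (fun s y => pd ord0 g (cons_rV s y)) Fs Fneq I.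
have {}C : (fun k : R => k^-1 *: (box_int a b (fun y => g (cons_rV (k *: 1 + s) y))
    - box_int a b (fun y => g (cons_rV s y)))) @ 0^' -->
    box_int a b (fun y => pd ord0 g (cons_rV s y)).
  have E : (fun k : R => k^-1 *: (box_int a b (fun y => g (cons_rV (k *: 1 + s) y))
    - box_int a b (fun y => g (cons_rV s y)))) =
    (fun u : R => (u - s)^-1 *: (box_int a b (fun y => g (cons_rV u y))
    - box_int a b (fun y => g (cons_rV s y)))) \o (fun k : R => k *: 1 + s).
    by apply/funext => k /=; rewrite addrK [k *: 1]mulr1.
  rewrite E; apply: C.
  - by move=> u _; exact: continuous_cons_rV.
  - exact: continuous_cons_rV.
  - by move=> y; rewrite withinET; exact: cvg_continuous_cons_rV.
  - move=> u y _; rewrite neq_lt => /orP[us|su].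
      have [c] := mvt u s y us; rewrite in_itv /= => /andP[uc cs] E'.
      exists c; split => //.
        by rewrite !ltr0_norm ?subr_lt0// lerN2 lerD2r ltW.
      by rewrite -opprB E' -mulrN opprB.
    have [c] := mvt s u y su; rewrite in_itv /= => /andP[sc cu] E'.
    exists c; split => //.
    by rewrite !gtr0_norm ?subr_gt0// lerD2r ltW.
split; first by apply/cvg_ex; eexists; exact: C.
exact: (cvg_lim _ C).
Qed.

(** Along the first axis, differentiation comes out of the inner integral and the fundamental
    theorem leaves the difference of two face integrals; along any other axis each slice integral
    vanishes by induction. Periodicity is required only from the face [x 0 i = a 0 i] of the closed
    box, since moments of a flux need not have it elsewhere. *)
Lemma box_int_pd n (a b : 'rV[R]_n) (i : 'I_n) (g : 'rV[R]_n -> R) :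
  (forall j, a 0 j < b 0 j) ->
  continuous g -> (forall x, derivable g x (basis_vec i)) ->
  continuous (pd i g) ->
  (forall x : 'rV[R]_n, (forall j, a 0 j <= x 0 j <= b 0 j) -> x 0 i = a 0 i ->
     g (x + (b 0 i - a 0 i) *: basis_vec i) = g x) ->
  box_int a b (pd i g) = 0.
Proof.
elim: n a b i g => [|n IH] a b i g ab cg dg cdg per; first by case: i cdg dg per.
rewrite box_intS.
have [E|[j E]] := ord_splitP i; subst i; last first.
  rewrite (@eq_Rintegral _ _ _ mu _ (cst 0)) ?Rintegral_cst ?mul0r//.
  move=> s /set_mem sab; rewrite -pd_cons_rVS; apply: IH.
  - by move=> k; rewrite !mxE.
  - exact: continuous_cons_rV.
  - by move=> y; apply: derivable_cons_rVS.
  - by rewrite pd_cons_rVS; exact: continuous_cons_rV.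
  - move=> y yab ya; rewrite addrC -cons_rV_shiftS addrC !mxE per//.
      move=> k; have [->|[m ->]] := ord_splitP k; rewrite ?cons_rV0 ?cons_rVS.
        by move: sab; rewrite /= in_itv /= => /andP[? ?]; rewrite !ltW.
      by have := yab m; rewrite !mxE.
    by rewrite cons_rVS ya mxE.
have dG s := @is_derive_box_int_cons n (@rsubmx R 1 1 n a) (@rsubmx R 1 1 n b) g s cg dg cdg.
under eq_Rintegral => s _ do rewrite -(@derive_val _ _ _ _ _ _ _ (dG s)).
rewrite itv_int_derive//; last first.
  rewrite (_ : (fun _ => _) = fun s => box_int (@rsubmx R 1 1 n a) (@rsubmx R 1 1 n b)
    (fun y => pd ord0 g (cons_rV s y))); first exact: continuous_box_int_cons.
  by apply/funext => s; exact: (@derive_val _ _ _ _ _ _ _ (dG s)).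
apply/eqP; rewrite subr_eq0; apply/eqP; apply: eq_box_int => y /set_mem yab.
rewrite -[RHS]per; last exact: cons_rV0.
  by rewrite addrC cons_rV_shift0 subrK.
move=> k; have [->|[m ->]] := ord_splitP k; rewrite ?cons_rV0 ?cons_rVS.
  by rewrite lexx ltW.
by have := yab m; rewrite !mxE => /andP[? ?]; rewrite !ltW.
Qed.

End DivergenceTheorem.

(** * Regularity in time and derivatives of space integrals *)

Section TimeRegularity.
Context {R : realType} {n : nat} (T : R).
Implicit Types (h g : R -> 'rV[R]_n -> R) (t : R) (y : 'rV[R]_n).

(** Stated with the product filter that [box_int_quotient_cvg] consumes. Time 0 is left out because
    the time derivatives are controlled only at positive times. *)
Definition jointly_continuous {W : topologicalType} (h : R -> 'rV[R]_n -> W) :=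
  forall t y, t \in `]0, T] ->
    h z.1 z.2 @[z --> (within `]0, T] (nbhs t), nbhs y)] --> h t y.

Lemma jointly_continuous_within {W : topologicalType} (h : R -> 'rV[R]_n -> W) :
  {within `]0, T] `*` [set: 'rV[R]_n], continuous (fun z => h z.1 z.2)} ->
  jointly_continuous h.
Proof.
move=> /subspace_continuousP ch t y tT.
have /ch : (`]0, T] `*` [set: 'rV[R]_n]) (t, y) by split.
apply: cvg_trans.
apply: cvg_app => U [[/= V1 V2] [tV yV] VU].
exists ([set s | s \in `]0, T] /\ V1 s], V2); first split => //=.
  by move: tV; rewrite /within /=; apply: filterS => s Vs sT; split => //; exact: Vs.
move=> [s z] /= [[sT V1s] V2z].
by apply: (VU (s, z)); split.
Qed.

Lemma jointly_continuousD h g :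
  jointly_continuous h -> jointly_continuous g ->
  jointly_continuous (fun t y => h t y + g t y).
Proof. by move=> ch cg t y tT; apply: cvgD; [exact: ch|exact: cg]. Qed.

Lemma jointly_continuousM h g :
  jointly_continuous h -> jointly_continuous g ->
  jointly_continuous (fun t y => h t y * g t y).
Proof. by move=> ch cg t y tT; apply: cvgM; [exact: ch|exact: cg]. Qed.

Lemma jointly_continuous_space (w : 'rV[R]_n -> R) :
  continuous w -> jointly_continuous (fun _ => w).
Proof.
move=> cw t y tT; apply: (@cvg_comp _ _ _ snd w _ (nbhs y)); last exact: cw.
exact: cvg_snd.
Qed.

Lemma jointly_continuous_section h t :
  jointly_continuous h -> t \in `]0, T] -> continuous (h t).
Proof.
move=> ch tT y.
apply: (@cvg_comp _ _ _ (fun y => (t, y)) (fun z => h z.1 z.2) _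
  (nbhs (within `]0, T] (nbhs t), nbhs y))); last exact: ch.
apply: (@cvg_pair _ _ _ (nbhs y)); last exact: cvg_id.
move=> U tU; have Ut : U t by exact: (nbhs_singleton tU tT).
exact: (filterS (fun _ _ => Ut) (@filterT _ (nbhs y) _)).
Qed.

Lemma jointly_continuous_time h t y :
  jointly_continuous h -> t \in `]0, T] ->
  h s y @[s --> within `]0, T] (nbhs t)] --> h t y.
Proof.
move=> ch tT.
apply: (@cvg_comp _ _ _ (fun s => (s, y)) (fun z => h z.1 z.2) _
  (nbhs (within `]0, T] (nbhs t), nbhs y))); last exact: ch.
by apply: (@cvg_pair _ _ _ (within `]0, T] (nbhs t))); [exact: cvg_id|exact: (@cvg_cst 'rV[R]_n)].
Qed.

Definition dt_nbhs t : set_system R := within `[0, T] t^'.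

(** Because [t > 0], points of [[0, T]] close to [t] are positive. *)
Lemma dt_nbhs_subset t : t \in `]0, T] -> dt_nbhs t --> within `]0, T] (nbhs t).
Proof.
rewrite in_itv /= => /andP[t0 _] U tU.
suff: \forall s \near t^', s \in `[0, T] -> U s by [].
near=> s => s0.
have : s \in `]0, T] -> U s by near: s; apply: nbhs_dnbhs; exact: tU.
move: s0; rewrite /= !in_itv /= => /andP[_ ->]; rewrite andbT; apply.
by near: s; apply: nbhs_dnbhs; exact: lt_nbhsr.
Unshelve. all: by end_near. Qed.

Lemma dt_nbhs_neq t : \forall s \near dt_nbhs t, s != t.
Proof.
have : \forall s \near t^', s != t by exact: nbhs_dnbhs_neq.
by apply: filterS => s st _.
Qed.

#[global] Instance dt_nbhs_filter t : Filter (dt_nbhs t).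
Proof. exact: within_filter. Qed.

(** Properness makes limits unique, so that [dt] returns any derivative that exists. *)
Lemma dt_nbhs_proper t : t \in `]0, T] -> ProperFilter (dt_nbhs t).
Proof.
rewrite in_itv /= => /andP[t0 tT]; split; last exact: dt_nbhs_filter.
(* The witness lies to the left of [t], hence in the interval even at [t = T]; the minimum with [t]
   keeps it nonnegative. *)
move=> [e /= e0 /(_ (t - Num.min (e / 2) t))].
have m0 : 0 < Num.min (e / 2) t by rewrite lt_min t0 divr_gt0.
have me : Num.min (e / 2) t < e.
  by rewrite gt_min [X in X || _]ltr_pdivrMr// ltr_pMr// ltr1n.
rewrite /ball /= opprB addrC subrK gtr0_norm// => /(_ me); apply.
  by rewrite -subr_eq0 addrAC subrr sub0r oppr_eq0 gt_eqF.
by rewrite in_itv /= subr_ge0 ge_min lexx orbT /= (le_trans _ tT)// gerBl ltW.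
Qed.

(** The derivative [h'] is a parameter, not [dt] of [h], so that sums and products produce it in
    closed form. *)
Definition time_C1 h h' := [/\ jointly_continuous h, jointly_continuous h' &
  forall t y, t \in `]0, T] -> has_dt T (fun s => h s y : R^o) t (h' t y)].

Lemma time_C1D h h' g g' : time_C1 h h' -> time_C1 g g' ->
  time_C1 (fun t y => h t y + g t y) (fun t y => h' t y + g' t y).
Proof.
move=> [ch ch' dh] [cg cg' dg]; split; [exact: jointly_continuousD..|].
move=> t y tT; rewrite /has_dt /dt_filter.
under eq_cvg do rewrite opprD addrACA scalerDr.
exact: cvgD (dh t y tT) (dg t y tT).
Qed.

Lemma time_C1M h h' g g' : time_C1 h h' -> time_C1 g g' ->
  time_C1 (fun t y => h t y * g t y) (fun t y => h' t y * g t y + h t y * g' t y).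
Proof.
move=> [ch ch' dh] [cg cg' dg]; split.
- exact: jointly_continuousM.
- by apply: jointly_continuousD; exact: jointly_continuousM.
move=> t y tT.
have hs : h s y @[s --> dt_nbhs t] --> h t y.
  exact: cvg_trans (cvg_app _ (dt_nbhs_subset tT)) (jointly_continuous_time ch tT).
have gt : g t y @[s --> dt_nbhs t] --> g t y by exact: cvg_cst.
have E : (fun s => (s - t)^-1 *: (h s y * g s y - h t y * g t y)) =1
    (fun s => (s - t)^-1 * (h s y - h t y) * g t y
              + h s y * ((s - t)^-1 * (g s y - g t y))).
  by move=> s; rewrite /GRing.scale/=; ring.
rewrite /has_dt /dt_filter (eq_cvg _ _ E).
exact: cvgD (cvgM (dh t y tT) gt) (cvgM hs (dg t y tT)).
Qed.

Lemma time_C1_space (w : 'rV[R]_n -> R) : continuous w ->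
  time_C1 (fun _ => w) (fun _ _ => 0).
Proof.
move=> cw; split; first exact: jointly_continuous_space.
  by apply: jointly_continuous_space; exact: cst_continuous.
move=> t y tT; rewrite /has_dt /dt_filter.
under eq_cvg do rewrite subrr scaler0.
exact: cvg_cst.
Qed.

Lemma time_C1_cst (c : R) : time_C1 (fun _ _ => c) (fun _ _ => 0).
Proof. by apply: time_C1_space; exact: cst_continuous. Qed.

Lemma time_C1B h h' g g' : time_C1 h h' -> time_C1 g g' ->
  time_C1 (fun t y => h t y - g t y) (fun t y => h' t y - g' t y).
Proof.
move=> Ch Cg; have := time_C1D Ch (time_C1M (time_C1_cst (-1)) Cg).
congr time_C1; apply/funext => t; apply/funext => y; first by rewrite mulN1r.
by rewrite mul0r add0r mulN1r.
Qed.

Lemma time_C1_sum I (r : seq I) (h h' : I -> R -> 'rV[R]_n -> R) :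
  (forall i, time_C1 (h i) (h' i)) ->
  time_C1 (fun t y => \sum_(i <- r) h i t y) (fun t y => \sum_(i <- r) h' i t y).
Proof.
move=> Ch; elim: r => [|i r IH].
  under eq_fun => t do under eq_fun do rewrite big_nil.
  under [X in time_C1 _ X]eq_fun => t do under eq_fun do rewrite big_nil.
  exact: time_C1_cst.
under eq_fun => t do under eq_fun do rewrite big_cons.
under [X in time_C1 _ X]eq_fun => t do under eq_fun do rewrite big_cons.
exact: time_C1D.
Qed.

(** A small punctured neighbourhood of an interior time lies in [[0, T]], so the relative derivative
    is two-sided there, the form needed by the mean value theorem. *)
Lemma has_dt_is_derive (f : R -> R) t l : t \in `]0, T[ ->
  has_dt T (f : R -> R^o) t l -> is_derive t 1 f l.
Proof.
rewrite in_itv /= => /andP[t0 tT] fl.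
have C : (fun k : R => k^-1 *: (f (k *: 1 + t) - f t)) @ 0^' --> l.
  rewrite (_ : (fun k => _) = (fun s => (s - t)^-1 *: (f s - f t)) \o
      (fun k : R => k *: 1 + t)); last first.
    by apply/funext => k /=; rewrite addrK [k *: 1]mulr1.
  apply: cvg_comp fl => U [e /= e0 eU].
  near=> k => /=; rewrite [k *: 1]mulr1; apply: eU => /=.
  - rewrite /ball /= opprD addrCA subrr addr0 normrN; near: k.
    by apply: nbhs_dnbhs; exists e => //= k /=; rewrite sub0r normrN.
  - by rewrite -subr_eq0 addrK; near: k; exact: nbhs_dnbhs_neq.
  - rewrite in_itv /=; apply/andP; split; near: k; apply: nbhs_dnbhs.
      exists t => //= k /=; rewrite sub0r normrN => kt.
      by rewrite -lerBlDr sub0r; have := ltW kt; rewrite ler_norml => /andP[].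
    exists (T - t) => /=; first by rewrite subr_gt0.
    move=> k /=; rewrite sub0r normrN => kt.
    by rewrite -lerBrDr; have := ltW kt; rewrite ler_norml => /andP[].
split; first by apply/cvg_ex; exists l; exact: C.
exact: (cvg_lim _ C).
Unshelve. all: by end_near. Qed.

(** Only points strictly between [s] and [t] need a derivative, and they lie in []0, T[] even when
    [t = T]; joint continuity covers the end points. *)
Lemma time_C1_MVT h h' (s t : R) y : time_C1 h h' ->
  s \in `]0, T] -> t \in `]0, T] -> s < t ->
  exists2 c, c \in `]s, t[ & h t y - h s y = h' c y * (t - s).
Proof.
move=> [ch ch' dh]; rewrite !in_itv /= => /andP[s0 sT] /andP[t0 tT] st.
apply: (@MVT _ (fun s => h s y) (fun s => h' s y)) => //.
  move=> c; rewrite in_itv /= => /andP[sc ct].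
  have c0 := lt_trans s0 sc; have cT := lt_le_trans ct tT.
  apply: has_dt_is_derive; first by rewrite in_itv /= c0 cT.
  by apply: dh; rewrite in_itv /= c0 ltW.
apply/subspace_continuousP => z /=; rewrite in_itv /= => /andP[sz zt].
have zT : z \in `]0, T] by rewrite in_itv /= (lt_le_trans s0 sz) (le_trans zt tT).
apply: cvg_trans (jointly_continuous_time (y := y) ch zT).
apply: cvg_app; apply: within_subset => u /=; rewrite !in_itv /= => /andP[su ut].
by rewrite (lt_le_trans s0 su) (le_trans ut tT).
Qed.

Lemma has_dt_box_int (a b : 'rV[R]_n) h h' t : time_C1 h h' -> t \in `]0, T] ->
  has_dt T (fun s => box_int a b (h s) : R^o) t (box_int a b (h' t)).
Proof.
move=> Ch tT; have [ch ch' dh] := Ch.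
apply: (@box_int_quotient_cvg _ (dt_nbhs t) _ `]0, T]%classic).
- exact: dt_nbhs_subset.
- exact: dt_nbhs_neq.
- exact: tT.
- by move=> s sT; exact: jointly_continuous_section.
- exact: jointly_continuous_section.
- by move=> y; exact: ch'.
- move=> s y sT; rewrite neq_lt => /orP[st|ts].
    have [c] := time_C1_MVT y Ch sT tT st; rewrite in_itv /= => /andP[sc ct] E.
    exists c; split.
    + move: sT tT; rewrite /= !in_itv /= => /andP[s0 _] /andP[_ tT].
      by rewrite (lt_trans s0 sc) (le_trans (ltW ct) tT).
    + by rewrite !ltr0_norm ?subr_lt0// lerN2 lerD2r ltW.
    + by rewrite -opprB E -mulrN opprB.
  have [c] := time_C1_MVT y Ch tT sT ts; rewrite in_itv /= => /andP[tc cs] E.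
  exists c; split => //.
  + move: sT tT; rewrite /= !in_itv /= => /andP[_ sT] /andP[t0 _].
    by rewrite (lt_trans t0 tc) (le_trans (ltW cs) sT).
  + by rewrite !gtr0_norm ?subr_gt0// lerD2r ltW.
Qed.

Lemma has_dtZ (c : R) (f : R -> R) t l :
  has_dt T (f : R -> R^o) t l -> has_dt T ((fun s => c * f s) : R -> R^o) t (c * l).
Proof.
move=> fl; have E : (fun s => (s - t)^-1 *: (c * f s - c * f t)) =1
    (fun s => c * ((s - t)^-1 *: (f s - f t))).
  by move=> s; rewrite /GRing.scale/= -mulrBr mulrCA.
rewrite /has_dt /dt_filter (eq_cvg _ _ E).
by apply: cvgM; [exact: (@cvg_cst R)|exact: fl].
Qed.

Lemma has_dt_row m (f : R -> 'rV[R]_m) t (l : 'rV[R]_m) :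
  (forall j, has_dt T (fun s => f s 0 j : R^o) t (l 0 j)) -> has_dt T f t l.
Proof.
move=> fl; apply: (@cvg_coord _ _ (dt_nbhs t)) => i j; rewrite ord1.
by under eq_cvg do rewrite !mxE; exact: fl.
Qed.

Lemma has_dt_coord m (f : R -> 'rV[R]_m) t (l : 'rV[R]_m) j :
  has_dt T f t l -> has_dt T (fun s => f s 0 j : R^o) t (l 0 j).
Proof.
move=> fl; have E : (fun s => (s - t)^-1 *: (f s 0 j - f t 0 j)) =1
    (fun M : 'rV[R]_m => M 0 j) \o (fun s => (s - t)^-1 *: (f s - f t)).
  by move=> s; rewrite /= !mxE.
rewrite /has_dt /dt_filter (eq_cvg _ _ E).
exact: (cvg_comp _ _ fl (@coord_continuous _ _ _ 0 j l)).
Qed.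

Lemma has_dt_dt {V : normedModType R} (f : R -> V) t l :
  t \in `]0, T] -> has_dt T f t l -> dt T f t = l.
Proof.
by move=> /dt_nbhs_proper ? fl; apply: cvg_lim => //; exact: norm_hausdorff.
Qed.

End TimeRegularity.

(** * Functions of class C^1 with explicit gradients *)

Section Gradients.
Context {R : realType} {d : nat}.
Implicit Types (g h : 'rV[R]_d -> R) (G H : 'I_d -> 'rV[R]_d -> R) (a b : 'rV[R]_d).

(** Pairing the regularity with a formula [G] lets the rules below prove smoothness and compute
    partial derivatives together. *)
Definition has_grad g G := Ck 1 g /\ forall i x, pd i g x = G i x.

Lemma Ck1P g : Ck 1 g <-> [/\ continuous g,
  forall i x, derivable g x (basis_vec i) & forall i, continuous (pd i g)].
Proof.
split.
  by move=> [cg dg]; split=> [//|i|i]; have [dgi [cdgi _]] := dg i; [exact: dgi|exact: cdgi].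
by move=> [cg dg cdg]; split.
Qed.

Lemma Ck_has_grad g : Ck 1 g -> has_grad g (fun i => pd i g).
Proof. by []. Qed.

Lemma Ck2_Ck1 g : Ck 2 g -> Ck 1 g.
Proof.
move=> [cg dg]; apply/Ck1P; split => // i; first by have [] := dg i.
by have [_ [cdgi _]] := dg i; exact: cdgi.
Qed.

Lemma Ck2_pd g i : Ck 2 g -> Ck 1 (pd i g).
Proof. by move=> [_ /(_ i)[]]. Qed.

Lemma has_grad_intro g G : continuous g ->
  (forall i x, is_derive x (basis_vec i) g (G i x)) ->
  (forall i, continuous (G i)) -> has_grad g G.
Proof.
move=> cg dg cG.
have E i x : pd i g x = G i x by rewrite /pd; apply: derive_val.
split => //; apply/Ck1P; split => [//|i x|i]; first by have [] := dg i x.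
by rewrite (_ : pd i g = G i)//; apply/funext.
Qed.

Lemma has_grad_elim g G : has_grad g G -> [/\ continuous g,
  forall i x, is_derive x (basis_vec i) g (G i x) & forall i, continuous (G i)].
Proof.
move=> [/Ck1P[cg dg cdg] E]; split => // i.
  by move=> x; apply: DeriveDef => //; exact: E.
by rewrite (_ : G i = pd i g)//; apply/funext => x; rewrite E.
Qed.

Lemma continuous_addf g h : continuous g -> continuous h ->
  continuous (fun x => g x + h x).
Proof. by move=> cg ch x; apply: (@continuousD _ _ _ g h); [exact: cg|exact: ch]. Qed.

Lemma continuous_mulf g h : continuous g -> continuous h ->
  continuous (fun x => g x * h x).
Proof. by move=> cg ch x; apply: (@continuousM _ _ g h); [exact: cg|exact: ch]. Qed.

Lemma has_gradD g h G H : has_grad g G -> has_grad h H ->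
  has_grad (fun x => g x + h x) (fun i x => G i x + H i x).
Proof.
move=> /has_grad_elim[cg dg cG] /has_grad_elim[ch dh cH].
apply: has_grad_intro => [|i]; exact: continuous_addf.
Qed.

Lemma has_gradM g h G H : has_grad g G -> has_grad h H ->
  has_grad (fun x => g x * h x) (fun i x => G i x * h x + g x * H i x).
Proof.
move=> /has_grad_elim[cg dg cG] /has_grad_elim[ch dh cH].
apply: has_grad_intro; [|move=> i x|move=> i].
- exact: continuous_mulf.
- apply: is_derive_eq.
  by rewrite /GRing.scale/= addrC [h x * _]mulrC.
- by apply: continuous_addf; exact: continuous_mulf.
Qed.

Lemma has_grad_cst (c : R) : has_grad (fun=> c) (fun _ _ => 0).
Proof.
by apply: has_grad_intro => [|i]; exact: cst_continuous.
Qed.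

Lemma has_gradZ (c : R) g G : has_grad g G ->
  has_grad (fun x => c * g x) (fun i x => c * G i x).
Proof.
move=> hg; have [Cg E] := has_gradM (has_grad_cst c) hg.
by split => // i x; rewrite E mul0r add0r.
Qed.

Lemma has_gradN g G : has_grad g G -> has_grad (fun x => - g x) (fun i x => - G i x).
Proof.
move=> /(has_gradZ (-1)); congr has_grad.
  by apply/funext => x; rewrite mulN1r.
by apply/funext => i; apply/funext => x; rewrite mulN1r.
Qed.

Lemma has_grad_sum I (r : seq I) (g : I -> 'rV[R]_d -> R) (G : I -> 'I_d -> 'rV[R]_d -> R) :
  (forall l, has_grad (g l) (G l)) ->
  has_grad (fun x => \sum_(l <- r) g l x) (fun i x => \sum_(l <- r) G l i x).
Proof.
move=> hg; elim: r => [|l r IH].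
  have [C E] := has_grad_cst 0; under eq_fun do rewrite big_nil.
  by split => // i x; rewrite E big_nil.
have [C E] := has_gradD (hg l) IH; under eq_fun do rewrite big_cons.
by split => // i x; rewrite E big_cons.
Qed.

Lemma has_grad_coord k :
  has_grad (fun x : 'rV[R]_d => x 0 k) (fun i _ => (i == k)%:R).
Proof.
apply: has_grad_intro; first exact: coord_continuous.
  move=> i x; have C : (fun c : R => c^-1 *: ((c *: basis_vec i + x) 0 k - x 0 k)) @ 0^'
      --> ((i == k)%:R : R).
    apply: (cvg_trans _ (@cvg_cst R (i == k)%:R _ (0^') _)).
    apply: near_eq_cvg; near=> c; rewrite !mxE eqxx /= addrK eq_sym.
    by rewrite [_ *: _]mulrA mulVf ?mul1r//; near: c; exact: nbhs_dnbhs_neq.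
  by split; [apply/cvg_ex; eexists; exact: C|exact: (cvg_lim _ C)].
by move=> i; exact: cst_continuous.
Unshelve. all: by end_near. Qed.

Lemma periodic_pd a b g (i : 'I_d) : Defs.periodic a b g -> Defs.periodic a b (pd i g).
Proof.
move=> pg j x; rewrite /pd /derive; congr (lim (_ @ 0^')); apply/funext => c.
by rewrite pg /= addrA pg.
Qed.

Lemma box_int_pd_periodic a b (i : 'I_d) g : (forall j, a 0 j < b 0 j) ->
  Ck 1 g -> Defs.periodic a b g -> box_int a b (pd i g) = 0.
Proof.
move=> ab /Ck1P[cg dg cdg] pg; apply: box_int_pd => //.
Qed.

End Gradients.

(** * Pointwise algebra of the momentum and energy balances *)

Section FluxIdentities.
Context {R : realType} {d : nat}.
Implicit Types (u f : 'I_d -> R) (G K : 'I_d -> 'I_d -> R).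

Lemma sum_delta (j : 'I_d) (F : 'I_d -> R) : \sum_i (i == j)%:R * F i = F j.
Proof.
rewrite (bigD1 j)//= eqxx mul1r big1 ?addr0// => i /negPf ->.
by rewrite mul0r.
Qed.

(** All values at a point become free reals: [G i j], [K i j], [DM i j] and [DS i j] stand for the
    [i]-th derivatives of [u j], [f j], [m j] and the stress entry [(i, j)]. Once the divergence is
    expanded, the two terms carrying [\sum_i G i i] drop out and the rest is linear. *)
Lemma momentum_identity (A1 A2 A3 A4 A5 : R) u f (m dm dp : 'I_d -> R) G K
    (DM DS : 'I_d -> 'I_d -> R) j :
  \sum_i G i i = 0 ->
  dm j + \sum_i u i * DM i j + dp j = \sum_i DS i j +
    (A1 * \sum_l u l * K j l + A2 * \sum_i u i * K i j + A3 * \sum_l f l * G j l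
     + A4 * \sum_i f i * G i j + A5 * (\sum_i K i i) * u j) ->
  dm j = \sum_i (- (G i i * m j + u i * DM i j) + DS i j
      + A4 * (K i i * u j + f i * G i j) + A2 * (G i i * f j + u i * K i j)
      + (i == j)%:R * (A1 * (\sum_l (K i l * u l + f l * G i l)) - dp i))
    + (A3 - A1) * (\sum_l f l * G j l) + (A5 - A4) * (\sum_i K i i) * u j.
Proof.
move=> divu eqn; rewrite big_split sum_delta/=.
have -> : \sum_l (K j l * u l + f l * G j l) =
    \sum_l u l * K j l + \sum_l f l * G j l.
  by rewrite -big_split; apply: eq_bigr => l _ /=; rewrite [K j l * _]mulrC.
have -> : \sum_i (- (G i i * m j + u i * DM i j) + DS i j
      + A4 * (K i i * u j + f i * G i j) + A2 * (G i i * f j + u i * K i j)) =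
   - ((\sum_i G i i) * m j + \sum_i u i * DM i j) + \sum_i DS i j
      + A4 * ((\sum_i K i i) * u j + \sum_i f i * G i j)
      + A2 * ((\sum_i G i i) * f j + \sum_i u i * K i j).
  by rewrite !big_split/= sumrN -!mulr_sumr !big_split/= -!mulr_suml.
rewrite divu; move: eqn; lra.
Qed.

(** Here [r] is the density, [gr] its gradient, [dr] and [ut] are time derivatives, [df i] is the
    [i]-th derivative of [f i], and [DF i j] that of [Fl i j]. Testing the momentum balance with [u]
    leaves the sums [B], [C], [E], [V], [N]; [B] and [C] cancel against the added fluxes, and the
    mass equation handles the terms in [q]. *)
Lemma energy_identity (A1 A2 A3 A4 A5 r dr mu p : R) u f (ut gr df : 'I_d -> R) G
    (DF : 'I_d -> 'I_d -> R) :
  A1 + A2 - A3 = 0 -> A5 - 2^-1 * A4 = 2^-1 ->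
  \sum_i G i i = 0 -> dr + \sum_i u i * gr i = \sum_i df i ->
  (forall j, dr * u j + r * ut j = \sum_i DF i j +
     (A3 - A1) * (\sum_l f l * G j l) + (A5 - A4) * (\sum_i df i) * u j) ->
  let Fl i j := - (u i * (r * u j)) + mu * (G i j + G j i) + A4 * (f i * u j)
    + A2 * (u i * f j) + (i == j)%:R * (A1 * (\sum_l f l * u l) - p) in
  let q := \sum_l u l * u l in
  let dq i := \sum_l (G i l * u l + u l * G i l) in
  2^-1 * (dr * q + r * \sum_l (ut l * u l + u l * ut l)) =
  \sum_i (\sum_j (G i j * Fl i j + u j * DF i j)
    + 2^-1 * ((gr i * (u i * q) + r * (G i i * q + u i * dq i)))
    - 2^-1 * A4 * (df i * q + f i * dq i))
  - 2^-1 * mu * \sum_i \sum_j (G i j + G j i) ^+ 2.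
Proof.
move=> hA13 hA45 divu mass mom Fl q dq.
pose B := \sum_i \sum_j u i * u j * G i j.
pose C := \sum_i \sum_j f i * u j * G i j.
pose E := \sum_i \sum_j u i * f j * G i j.
pose V := \sum_i \sum_j (G i j + G j i) ^+ 2.
pose N := \sum_l u l * ut l.
(* The isotropic part of the flux enters only through [k * \sum_i G i i], which is zero; an opaque
   [k] keeps it a single atom for [ring]. *)
have [k kE] : exists k, k = A1 * (\sum_l f l * u l) - p by eexists.
(* Exchanging the indices turns [G i j] into [G j i] and keeps the symmetric factor, so twice the
   left side is [V]. *)
have VE : \sum_i \sum_j G i j * (G i j + G j i) = 2^-1 * V.
  have : \sum_i \sum_j G i j * (G i j + G j i) + \sum_i \sum_j G i j * (G i j + G j i) = V.
    rewrite [X in _ + X]exchange_big -big_split; apply: eq_bigr => i _.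
    by rewrite -big_split; apply: eq_bigr => j _ /=; ring.
  lra.
have dqE i : dq i = 2 * \sum_l u l * G i l.
  by rewrite mulr_sumr; apply: eq_bigr => l _; ring.
have uB : \sum_i u i * dq i = 2 * B.
  rewrite mulr_sumr; apply: eq_bigr => i _; rewrite dqE mulrCA; congr (_ * _).
  by rewrite mulr_sumr; apply: eq_bigr => l _; ring.
have fC : \sum_i f i * dq i = 2 * C.
  rewrite mulr_sumr; apply: eq_bigr => i _; rewrite dqE mulrCA; congr (_ * _).
  by rewrite mulr_sumr; apply: eq_bigr => l _; ring.
have T1 : \sum_i \sum_j G i j * Fl i j =
    - r * B + mu * (2^-1 * V) + A4 * C + A2 * E + k * \sum_i G i i.
  rewrite -VE !mulr_sumr -!big_split/=; apply: eq_bigr => i _.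
  (* The diagonal term is written back as a sum against the Kronecker symbol, so that it joins the
     sum over [j]. *)
  rewrite -[k * G i i](sum_delta i (fun j => k * G i j)).
  rewrite !mulr_sumr -!big_split/=; apply: eq_bigr => j _.
  by rewrite /Fl -kE eq_sym; ring.
have T2 : \sum_i \sum_j u j * DF i j =
    dr * q + r * N - (A3 - A1) * E - (A5 - A4) * (\sum_i df i) * q.
  have [c cE] : exists c, c = (A5 - A4) * (\sum_i df i) by eexists.
  rewrite -cE exchange_big /= (eq_bigr (fun j => dr * (u j * u j) + r * (u j * ut j)
      - (A3 - A1) * (\sum_l u j * f l * G j l) - c * (u j * u j))).
    by rewrite !sumrB big_split/= -!mulr_sumr.
  move=> j _; rewrite -mulr_sumr.
  have -> : \sum_i DF i j = dr * u j + r * ut j -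
     (A3 - A1) * (\sum_l f l * G j l) - c * u j.
    by rewrite mom -cE; ring.
  have -> : \sum_l u j * f l * G j l = u j * \sum_l f l * G j l.
    by rewrite mulr_sumr; apply: eq_bigr => l _; rewrite mulrA.
  by ring.
have NE : \sum_l (ut l * u l + u l * ut l) = 2 * N.
  by rewrite mulr_sumr; apply: eq_bigr => l _; ring.
have T3 : \sum_i (gr i * (u i * q) + r * (G i i * q + u i * dq i)) =
    (\sum_i u i * gr i) * q + r * ((\sum_i G i i) * q + 2 * B).
  rewrite -uB big_split -mulr_sumr big_split/= !mulr_suml.
  by congr (_ + _); apply: eq_bigr => i _; ring.
have T4 : \sum_i (df i * q + f i * dq i) = (\sum_i df i) * q + 2 * C.
  by rewrite -fC big_split/= mulr_suml.
rewrite -/V NE sumrB big_split/= -!mulr_sumr T3 T4.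
under eq_bigr do rewrite big_split/=.
rewrite big_split/= T1 T2 divu.
have -> : \sum_i u i * gr i = \sum_i df i - dr by rewrite -mass; ring.
(* On the right, [E] now has coefficient [A1 + A2 - A3], and [q] times the divergence of [f] has
   coefficient [1/2 - A5 + A4/2]; the two hypotheses make them vanish. *)
have -> : A3 = A1 + A2 by move: hA13; lra.
have -> : A5 = 2^-1 + 2^-1 * A4 by move: hA45; lra.
by field.
Qed.

End FluxIdentities.

(** * The momentum flux: regularity, balance, periodicity *)

Section MomentumFlux.
Context {R : realType} {d : nat}.
Implicit Types (kappa mu : 'rV[R]_d -> R) (a b : 'rV[R]_d).
Implicit Types (m u f : 'rV[R]_d -> 'rV[R]_d).

Definition momentum_flux (A1 A2 A4 : R) mu m u f (p : 'rV[R]_d -> R)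
    (i j : 'I_d) (x : 'rV[R]_d) : R :=
  - (u x 0 i * m x 0 j) + viscous_stress mu u x i j
  + A4 * (f x 0 i * u x 0 j) + A2 * (u x 0 i * f x 0 j)
  + (i == j)%:R * (A1 * (\sum_l f x 0 l * u x 0 l) - p x).

Lemma viscous_stressE mu u x i j : viscous_stress mu u x i j =
  mu x * (pd i (fun y => u y 0 j) x + pd j (fun y => u y 0 i) x).
Proof. by rewrite !mxE. Qed.

Lemma Ck1_viscous_stress mu u i j : Ck 1 mu -> Ckv 2 u ->
  Ck 1 (fun x => viscous_stress mu u x i j).
Proof.
move=> Cmu Cu; under eq_fun do rewrite viscous_stressE.
have h := has_gradM (Ck_has_grad Cmu) (has_gradD (Ck_has_grad (Ck2_pd i (Cu j)))
  (Ck_has_grad (Ck2_pd j (Cu i)))).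
by have [] := h.
Qed.

(** The summands follow [momentum_identity] term by term; the viscous stress stays a single function
    because its divergence enters the equation unexpanded. *)
Lemma has_grad_momentum_flux A1 A2 A4 mu m u f p i j :
  Ck 1 mu -> Ckv 1 m -> Ckv 2 u -> Ckv 1 f -> Ck 1 p ->
  has_grad (momentum_flux A1 A2 A4 mu m u f p i j) (fun k x =>
    - (pd k (fun y => u y 0 i) x * m x 0 j + u x 0 i * pd k (fun y => m y 0 j) x)
    + pd k (fun y => viscous_stress mu u y i j) x
    + A4 * (pd k (fun y => f y 0 i) x * u x 0 j + f x 0 i * pd k (fun y => u y 0 j) x)
    + A2 * (pd k (fun y => u y 0 i) x * f x 0 j + u x 0 i * pd k (fun y => f y 0 j) x)
    + (i == j)%:R * (A1 * (\sum_l (pd k (fun y => f y 0 l) x * u x 0 l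
        + f x 0 l * pd k (fun y => u y 0 l) x)) - pd k p x)).
Proof.
move=> Cmu Cm Cu Cf Cp.
have Hm l := Ck_has_grad (Cm l).
have Hu l := Ck_has_grad (Ck2_Ck1 (Cu l)).
have Hf l := Ck_has_grad (Cf l).
apply: has_gradD; last first.
  apply/has_gradZ/has_gradD; last exact: has_gradN (Ck_has_grad Cp).
  by apply/has_gradZ/has_grad_sum => l; exact: has_gradM.
apply: has_gradD; last exact/has_gradZ/has_gradM.
apply: has_gradD; last exact/has_gradZ/has_gradM.
apply: has_gradD; last exact: Ck_has_grad (Ck1_viscous_stress i j Cmu Cu).
exact/has_gradN/has_gradM.
Qed.

Lemma momentum_balance A1 A2 A3 A4 A5 mu m u f p (dm x : 'rV[R]_d) j :
  Ck 1 mu -> Ckv 1 m -> Ckv 2 u -> Ckv 1 f -> Ck 1 p ->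
  div u x = 0 ->
  dm + u x *m gradv m x + grad p x =
    0 + divm (viscous_stress mu u) x + f_m A1 A2 A3 A4 A5 u f x ->
  dm 0 j = \sum_i pd i (momentum_flux A1 A2 A4 mu m u f p i j) x
    + (A3 - A1) * (\sum_l f x 0 l * pd j (fun y => u y 0 l) x)
    + (A5 - A4) * div f x * u x 0 j.
Proof.
move=> Cmu Cm Cu Cf Cp divu eqn.
under eq_bigr => i _ do
  rewrite (has_grad_momentum_flux A1 A2 A4 i j Cmu Cm Cu Cf Cp).2.
apply: (@momentum_identity _ _ A1 A2 A3 A4 A5 (fun i => u x 0 i) (fun i => f x 0 i)
  (fun i => m x 0 i) (fun i => dm 0 i) (fun i => pd i p x)
  (fun i l => pd i (fun y => u y 0 l) x)
  (fun i l => pd i (fun y => f y 0 l) x)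
  (fun i l => pd i (fun y => m y 0 l) x)
  (fun i l => pd i (fun y => viscous_stress mu u y i l) x)) => //.
have := congr1 (fun v : 'rV[R]_d => v 0 j) eqn.
rewrite add0r /f_m /mulmv trmxK !mxE.
under [in X in X = _ -> _]eq_bigr do rewrite !mxE.
under [X in _ = _ + (A1 * X + _ + _ + _ + _) -> _]eq_bigr do rewrite !mxE.
under [X in _ = _ + (_ + A2 * X + _ + _ + _) -> _]eq_bigr do rewrite !mxE.
under [X in _ = _ + (_ + _ + A3 * X + _ + _) -> _]eq_bigr do rewrite !mxE.
under [X in _ = _ + (_ + _ + _ + A4 * X + _) -> _]eq_bigr do rewrite !mxE.
by [].
Qed.

Lemma Ckv1_momentum (rho : 'rV[R]_d -> R) u : Ck 1 rho -> Ckv 1 u ->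
  Ckv 1 (fun x => rho x *: u x).
Proof.
move=> Cr Cu j; under eq_fun do rewrite mxE.
by have [] := has_gradM (Ck_has_grad Cr) (Ck_has_grad (Cu j)).
Qed.

Lemma Ckv1_f_rho kappa (rho : 'rV[R]_d -> R) : Ck 1 kappa -> Ck 2 rho ->
  Ckv 1 (f_rho kappa rho).
Proof.
move=> Ck Cr j; under eq_fun do rewrite /f_rho !mxE.
by have [] := has_gradM (Ck_has_grad Ck) (Ck_has_grad (Ck2_pd j Cr)).
Qed.

Lemma periodic_coord a b u j :
  Defs.periodic a b u -> Defs.periodic a b (fun x => u x 0 j).
Proof. by move=> pu i x; rewrite pu. Qed.

Lemma periodic_f_rho a b kappa (rho : 'rV[R]_d -> R) :
  Defs.periodic a b kappa -> Defs.periodic a b rho ->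
  Defs.periodic a b (f_rho kappa rho).
Proof.
move=> pk pr i x; rewrite /f_rho pk; congr (_ *: _).
by apply/rowP => j; rewrite !mxE periodic_pd.
Qed.

Lemma periodic_viscous_stress a b mu u :
  Defs.periodic a b mu -> Defs.periodic a b u ->
  Defs.periodic a b (viscous_stress mu u).
Proof.
move=> pmu pu i x; apply/matrixP => k l.
by rewrite !viscous_stressE pmu !(periodic_pd _ (periodic_coord _ pu)).
Qed.

Lemma periodic_momentum_flux A1 A2 A4 a b mu m u f p i j :
  Defs.periodic a b mu -> Defs.periodic a b m -> Defs.periodic a b u ->
  Defs.periodic a b f -> Defs.periodic a b p ->
  Defs.periodic a b (momentum_flux A1 A2 A4 mu m u f p i j).
Proof.
move=> pmu pm pu pf pp k x.
by rewrite /momentum_flux pm pu pf pp (periodic_viscous_stress pmu pu).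
Qed.

End MomentumFlux.

(** * Application to a solution of the system *)

Section ConservationLaws.
Context {R : realType} {d : nat} (a b : 'rV[R]_d) (T : R).
Context (kappa mu : 'rV[R]_d -> R) (A1 A2 A3 A4 A5 : R).
Context (rho0 : 'rV[R]_d -> R) (u0 : 'rV[R]_d -> 'rV[R]_d).
Context (rho : R -> 'rV[R]_d -> R) (u : R -> 'rV[R]_d -> 'rV[R]_d).
Context (p : R -> 'rV[R]_d -> R).
Context (hab : forall i, a 0 i < b 0 i).
Context (hkappa : coefficient a b kappa) (hmu : coefficient a b mu).
Context (hsol : solution T a b kappa mu A1 A2 A3 A4 A5 (fun _ _ => 0)
              rho0 u0 rho u p).

Let drho (t : R) (x : 'rV[R]_d) : R := dt T (fun s => rho s x : R^o) t.
Let du (j : 'I_d) (t : R) (x : 'rV[R]_d) : R := dt T (fun s => u s x) t 0 j.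
Let m t x := rho t x *: u t x.
Let dm (j : 'I_d) (t : R) (x : 'rV[R]_d) : R := drho t x * u t x 0 j + rho t x * du j t x.
Let f t := f_rho kappa (rho t).
Let flux t := momentum_flux A1 A2 A4 mu (m t) (u t) (f t) (p t).

Let Cl := sol_classical hsol.

Lemma itv_oc_cc (t : R) : t \in `]0, T] -> t \in `[0, T].
Proof. by rewrite !in_itv /= => /andP[/ltW -> ->]. Qed.

Lemma time_C1_rho : time_C1 T rho drho.
Proof.
split.
- apply: jointly_continuous_within; apply: continuous_subspaceW (rho_continuous Cl).
  by move=> [t x] [] /= /itv_oc_cc.
- exact: jointly_continuous_within (rho_dt_continuous Cl).
- by move=> t x tT; exact: (rho_dt Cl tT).
Qed.

Lemma time_C1_u j : time_C1 T (fun t x => u t x 0 j) (du j).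
Proof.
have coord (h : R -> 'rV[R]_d -> 'rV[R]_d) : jointly_continuous T h ->
    jointly_continuous T (fun t x => h t x 0 j).
  move=> ch t x tT; apply: (@cvg_comp _ _ _ (fun z => h z.1 z.2)
    (fun v : 'rV[R]_d => v 0 j) _ _ _ (ch t x tT)).
  exact: (@coord_continuous R 1 d 0 j).
split.
- apply: coord; apply: jointly_continuous_within.
  apply: continuous_subspaceW (u_continuous Cl).
  by move=> [t x] [] /= /itv_oc_cc.
- by apply: coord; exact: jointly_continuous_within (u_dt_continuous Cl).
- by move=> t x tT; apply: has_dt_coord; exact: (u_dt Cl tT).
Qed.

Lemma time_C1_momentum j : time_C1 T (fun t x => momentum rho u t x 0 j) (dm j).
Proof.
have := time_C1M time_C1_rho (time_C1_u j); congr time_C1.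
by apply/funext => t; apply/funext => x; rewrite mxE.
Qed.

(** [dt] is a total limit operator; the product rule provides the convergence that gives it the
    expected value, so that the momentum equation can be exploited. *)
Lemma dt_momentum t x j : t \in `]0, T] ->
  dt T (fun s => momentum rho u s x) t 0 j = dm j t x.
Proof.
move=> tT; rewrite (@has_dt_dt _ _ _ _ _ (\row_l dm l t x)) ?mxE//.
apply: has_dt_row => l; rewrite mxE.
by have [_ _ ] := time_C1_momentum l; exact.
Qed.

(** * Balances and their integrals at a fixed positive time *)

Section AtTime.
Context (t : R) (tT : t \in `]0, T]).

Let Crho : Ck 2 (rho t) := rho_C2 Cl tT.
Let Cu : Ckv 2 (u t) := u_C2 Cl tT.
Let Cp : Ck 1 (p t) := p_C1 Cl tT.
Let Cu1 : Ckv 1 (u t) := fun j => Ck2_Ck1 (Cu j).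
Let Cmu : Ck 1 mu. Proof. by case: hmu. Qed.
Let Cf : Ckv 1 (f t). Proof. by apply: Ckv1_f_rho Crho; case: hkappa. Qed.
Let Cm : Ckv 1 (m t) := Ckv1_momentum (Ck2_Ck1 Crho) Cu1.
Let prho : Defs.periodic a b (rho t) := rho_periodic Cl (itv_oc_cc tT).
Let pu : Defs.periodic a b (u t) := u_periodic Cl (itv_oc_cc tT).
Let pp : Defs.periodic a b (p t) := p_periodic Cl tT.
Let pf : Defs.periodic a b (f t).
Proof. by apply: periodic_f_rho prho; case: hkappa. Qed.
Let pm : Defs.periodic a b (m t).
Proof. by move=> i x; rewrite /m prho pu. Qed.

Let pflux i j : Defs.periodic a b (flux t i j).
Proof. by apply: periodic_momentum_flux => //; case: hmu. Qed.

Let grad_flux i j : has_grad (flux t i j) (fun k => pd k (flux t i j)).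
Proof. by have [C _] := has_grad_momentum_flux A1 A2 A4 i j Cmu Cm Cu Cf Cp. Qed.

Lemma dm_balance j x : x \in box a b ->
  dm j t x = \sum_i pd i (flux t i j) x
    + (A3 - A1) * (\sum_l f t x 0 l * pd j (fun y => u t y 0 l) x)
    + (A5 - A4) * div (f t) x * u t x 0 j.
Proof.
move=> xab; rewrite -dt_momentum//.
apply: (momentum_balance j Cmu Cm Cu Cf Cp (sol_div_free hsol tT xab)).
exact: (sol_momentum hsol tT xab).
Qed.

Lemma box_int_dm j : A1 - A3 = 0 -> A5 - A4 = 0 -> box_int a b (dm j t) = 0.
Proof.
move=> h13 h54.
rewrite (@eq_box_int _ _ _ _ _ (fun x => \sum_i pd i (flux t i j) x)); last first.
  move=> x xab; rewrite dm_balance// h54 -opprB h13; ring.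
rewrite box_int_sum; last by move=> i; have [_ _] := has_grad_elim (grad_flux i j); exact.
by rewrite big1// => i _; apply: box_int_pd_periodic => //; have [] := grad_flux i j.
Qed.

(** Flux in direction [i] of the angular momentum in the plane of axes [j] and [l]. *)
Let moment_flux j l i x := flux t i j x * x 0 l - flux t i l x * x 0 j.

Let grad_moment_flux j l i : has_grad (moment_flux j l i) (fun k x =>
  (pd k (flux t i j) x * x 0 l + flux t i j x * (k == l)%:R)
  - (pd k (flux t i l) x * x 0 j + flux t i l x * (k == j)%:R)).
Proof.
by apply: has_gradD; [|apply: has_gradN];
  apply: has_gradM => //; exact: has_grad_coord.
Qed.

(** The flux is periodic, so a shift by one period changes the moment only through the positions: by
    the period length times [Flux_ij] if [l = i], or times [- Flux_il] if [j = i]. These are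
    off-diagonal entries, which vanish on the faces. *)
Lemma box_int_moment_flux j l i : j != l ->
  no_tangential_flux a b kappa mu (rho t) (u t) ->
  box_int a b (pd i (moment_flux j l i)) = 0.
Proof.
move=> jl noflux.
have [C E] := grad_moment_flux j l i; have [cg dg cdg] := (Ck1P _).1 C.
apply: box_int_pd => // x xab xi.
have {}/noflux[ui fu Sij] : x \in faces a b i by apply/mem_set; split => //; left.
(* A vanishing [u_i] removes both terms with that factor, [Sij] the stress, [fuk] the remaining
   diffusive term, and the Kronecker symbol the isotropic part. *)
have flux0 k : k != i -> flux t i k x = 0.
  move=> ki; have fuk : f t x 0 i * u t x 0 k = 0.
    by have := congr1 (fun v : 'rV[R]_d => v 0 k) fu; rewrite /= mxE [RHS]mxE.
  rewrite /flux /momentum_flux ui Sij// eq_sym (negPf ki) fuk.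
  by rewrite !mul0r !mulr0 oppr0 !addr0.
rewrite /moment_flux !pflux !mxE !eqxx/=.
have [li|li] := eqVneq l i; have [ji|ji] := eqVneq j i; rewrite ?mulr1 ?mulr0 ?addr0//.
- by move: jl; rewrite li ji eqxx.
- by rewrite flux0// !mul0r.
- by rewrite (flux0 l)// !mul0r.
Qed.

Lemma box_int_dm_moment j l : A1 - A3 = 0 -> A5 - A4 = 0 -> A2 = A4 -> j != l ->
  no_tangential_flux a b kappa mu (rho t) (u t) ->
  box_int a b (fun x => dm j t x * x 0 l - dm l t x * x 0 j) = 0.
Proof.
move=> h13 h54 h24 jl noflux.
(* [A2 = A4] makes the terms [f_i u_j] and [u_i f_j] trade places; advection is symmetric because
   momentum is parallel to velocity. *)
have flux_sym x : flux t l j x = flux t j l x.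
  rewrite /flux /momentum_flux !viscous_stressE h24 eq_sym /m !mxE; ring.
rewrite (@eq_box_int _ _ _ _ _ (fun x => \sum_i pd i (moment_flux j l i) x)).
  rewrite box_int_sum; first by rewrite big1// => i _; exact: box_int_moment_flux.
  by move=> i; have [_ _] := (Ck1P _).1 (grad_moment_flux j l i).1; exact.
move=> x xab; under eq_bigr => i _ do rewrite (grad_moment_flux j l i).2.
have h31 : A3 - A1 = 0 by rewrite -opprB h13 oppr0.
rewrite !dm_balance// h54 h31 sumrB !big_split/= -!mulr_suml.
under [X in _ = _ + X - _]eq_bigr do rewrite mulrC.
under [X in _ = _ - (_ + X)]eq_bigr do rewrite mulrC.
(* The derivatives of the positions contribute [Flux_lj - Flux_jl], which symmetry cancels. *)
rewrite !sum_delta flux_sym; ring.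
Qed.

Let q x := \sum_l u t x 0 l * u t x 0 l.
(** The last two terms cancel what advection and the [A4] term leave behind when the work of the
    momentum flux is differentiated. *)
Let energy_flux i x := \sum_j u t x 0 j * flux t i j x
  + 2^-1 * (rho t x * (u t x 0 i * q x)) - 2^-1 * A4 * (f t x 0 i * q x).

Let grad_energy_flux i : has_grad (energy_flux i) (fun k x =>
  let dq := \sum_l (pd k (fun y => u t y 0 l) x * u t x 0 l
                    + u t x 0 l * pd k (fun y => u t y 0 l) x) in
  \sum_j (pd k (fun y => u t y 0 j) x * flux t i j x + u t x 0 j * pd k (flux t i j) x)
  + 2^-1 * (pd k (rho t) x * (u t x 0 i * q x)
      + rho t x * (pd k (fun y => u t y 0 i) x * q x + u t x 0 i * dq))
  - 2^-1 * A4 * (pd k (fun y => f t y 0 i) x * q x + f t x 0 i * dq)).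
Proof.
have Hu l := Ck_has_grad (Cu1 l).
have Hq : has_grad q (fun k x => \sum_l (pd k (fun y => u t y 0 l) x * u t x 0 l
    + u t x 0 l * pd k (fun y => u t y 0 l) x)) by apply: has_grad_sum => l; exact: has_gradM (Hu l) (Hu l).
apply: has_gradD; last first.
  by apply/has_gradN/has_gradZ/has_gradM => //; exact: Ck_has_grad (Cf i).
apply: has_gradD; first by apply: has_grad_sum => j; exact: has_gradM.
by apply/has_gradZ/has_gradM; [exact: Ck_has_grad (Ck2_Ck1 Crho)|exact: has_gradM].
Qed.

Lemma periodic_energy_flux i : Defs.periodic a b (energy_flux i).
Proof.
move=> k x; rewrite /energy_flux /q prho pf pu.
by under eq_bigr do rewrite pflux.
Qed.

(** The viscous stress contracted with the velocity gradient, symmetrized into squares so that its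
    sign is visible. *)
Definition dissipation x := 2^-1 * mu x * \sum_i \sum_j
  (pd i (fun y => u t y 0 j) x + pd j (fun y => u t y 0 i) x) ^+ 2.

Lemma continuous_dissipation : continuous dissipation.
Proof.
apply: continuous_mulf.
  apply: continuous_mulf; first exact: cst_continuous.
  by have [] := (Ck1P _).1 Cmu.
apply: continuous_bigsum => i; apply: continuous_bigsum => j.
have cD : continuous
    (fun x => pd i (fun y => u t y 0 j) x + pd j (fun y => u t y 0 i) x).
  by apply: continuous_addf; [have [_ _] := (Ck1P _).1 (Cu1 j)
    |have [_ _] := (Ck1P _).1 (Cu1 i)]; exact.
exact: continuous_mulf.
Qed.

Lemma dissipation_ge0 x : 0 <= dissipation x.
Proof.
have [_ _ mu0] := hmu; rewrite mulr_ge0 ?mulr_ge0//.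
by apply: sumr_ge0 => i _; apply: sumr_ge0 => j _; exact: sqr_ge0.
Qed.

Lemma energy_balance x : A1 + A2 - A3 = 0 -> A5 - 2^-1 * A4 = 2^-1 -> x \in box a b ->
  2^-1 * (drho t x * q x
          + rho t x * \sum_l (du l t x * u t x 0 l + u t x 0 l * du l t x)) =
  \sum_i pd i (energy_flux i) x - dissipation x.
Proof.
move=> h123 h45 xab; under [X in _ = X - _]eq_bigr => i _ do
  rewrite (grad_energy_flux i).2.
have := @energy_identity _ _ A1 A2 A3 A4 A5 (rho t x) (drho t x) (mu x) (p t x)
  (fun i => u t x 0 i) (fun i => f t x 0 i) (fun i => du i t x)
  (fun i => pd i (rho t) x) (fun i => pd i (fun y => f t y 0 i) x)
  (fun i j => pd i (fun y => u t y 0 j) x) (fun i j => pd i (flux t i j) x)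
  h123 h45 (sol_div_free hsol tT xab).
move=> /=; rewrite -/(dissipation x) => ->.
- congr (_ - _); apply: eq_bigr => i _; congr (_ + _ - _).
  apply: eq_bigr => j _; congr (_ * _ + _).
  have mE : m t x 0 j = rho t x * u t x 0 j by rewrite mxE.
  by rewrite /flux /momentum_flux viscous_stressE mE.
- rewrite -[RHS](sol_mass hsol tT xab); congr (_ + _).
  by apply: eq_bigr => i _; rewrite mxE.
- by move=> j; rewrite -dm_balance.
Qed.

Lemma box_int_energy : A1 + A2 - A3 = 0 -> A5 - 2^-1 * A4 = 2^-1 ->
  2^-1 * box_int a b (fun x => drho t x * q x
    + rho t x * \sum_l (du l t x * u t x 0 l + u t x 0 l * du l t x)) <= 0.
Proof.
move=> h123 h45; rewrite -box_intZ; last first.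
  (* Linearity needs a continuous integrand; this one is the time derivative of [rho |u|^2], hence
     jointly continuous. *)
  have [_ ch' _] := time_C1M time_C1_rho (time_C1_sum (index_enum 'I_d)
    (fun l => time_C1M (time_C1_u l) (time_C1_u l))).
  exact: (jointly_continuous_section ch' tT).
rewrite (@eq_box_int _ _ _ _ _ (fun x => \sum_i pd i (energy_flux i) x - dissipation x));
  last by move=> x; exact: energy_balance.
have cE i : continuous (pd i (energy_flux i)).
  by have [_ _] := (Ck1P _).1 (grad_energy_flux i).1; exact.
rewrite box_intB; [|exact: continuous_bigsum|exact: continuous_dissipation].
rewrite box_int_sum// big1 ?sub0r ?oppr_le0; last first.
  move=> i _; apply: box_int_pd_periodic => //; first exact: (grad_energy_flux i).1.
  exact: periodic_energy_flux.
by apply: box_int_ge0 => x _; exact: dissipation_ge0.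
Qed.

End AtTime.
End ConservationLaws.

(** * Components of the cross product and the three balance statements *)

(* In dimension 2 the third coordinate of an extended vector is absent, so two
   of the three components of the cross product vanish identically. *)
Lemma cross_component (R : realType) (d : nat) (k : 'I_3) :
  (exists j l : 'I_d, j != l /\
     forall v w : 'rV[R]_d, cross v w 0 k = v 0 j * w 0 l - v 0 l * w 0 j) \/
  (forall v w : 'rV[R]_d, cross v w 0 k = 0).
Proof.
have crossE (v w : 'rV[R]_d) : cross v w 0 k = ext3 v 0 (k + 1) * ext3 w 0 (k + 2)
    - ext3 v 0 (k + 2) * ext3 w 0 (k + 1) by rewrite mxE.
have [j _ kj|j0] := insubP 'I_d (val (k + 1)); last first.
  by right => v w; rewrite crossE !mxE !(@insubN _ _ 'I_d (val (k + 1)) j0) !(mul0r, mulr0) subr0.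
have [l _ kl|l0] := insubP 'I_d (val (k + 2)); last first.
  by right => v w; rewrite crossE !mxE !(@insubN _ _ 'I_d (val (k + 2)) l0) !(mul0r, mulr0) subr0.
have cE (v w : 'rV[R]_d) : cross v w 0 k = v 0 j * w 0 l - v 0 l * w 0 j.
  rewrite crossE !mxE.
  have -> : insub (val (k + 1)) = Some j by rewrite -kj valK.
  by have -> : insub (val (k + 2)) = Some l by rewrite -kl valK.
(* Treating [j = l] as a vanishing component avoids arithmetic in ['I_3]. *)
have [jl|jl] := eqVneq j l; last by left; exists j, l.
by right => v w; rewrite cE jl mulrC subrr.
Qed.

Theorem theorem4p1 (R : realType) (d : nat) (hd : d = 2%N \/ d = 3%N)
    (a b : 'rV[R]_d) (hab : forall i, a 0 i < b 0 i)
    (T : R) (hT : 0 < T)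
    (kappa mu : 'rV[R]_d -> R)
    (hkappa : coefficient a b kappa) (hmu : coefficient a b mu)
    (A1 A2 A3 A4 A5 : R)
    (rho0 : 'rV[R]_d -> R) (u0 : 'rV[R]_d -> 'rV[R]_d)
    (rho : R -> 'rV[R]_d -> R) (u : R -> 'rV[R]_d -> 'rV[R]_d)
    (p : R -> 'rV[R]_d -> R)
    (hsol : solution T a b kappa mu A1 A2 A3 A4 A5 (fun _ _ => 0)
              rho0 u0 rho u p) :
  [/\ A1 + A2 - A3 = 0 -> A5 - 2^-1 * A4 = 2^-1 ->
        forall t : R, t \in `]0, T] ->
        exists2 l : R, has_dt T (kinetic_energy a b rho u : R -> R^o) t l
                     & l <= 0,
      A1 - A3 = 0 -> A5 - A4 = 0 ->
        forall t : R, t \in `]0, T] ->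
        has_dt T (total_momentum a b rho u) t 0
    & A1 - A3 = 0 -> A5 - A4 = 0 -> A2 = A4 ->
        (forall t : R, t \in `]0, T] ->
           no_tangential_flux a b kappa mu (rho t) (u t)) ->
        forall t : R, t \in `]0, T] ->
        has_dt T (angular_momentum a b rho u) t 0].

Proof.
split=> [h123 h45|h13 h54|h13 h54 h24 noflux] t tT.
(* The energy inequality determines the witness: half the integral of the time derivative of
   [rho |u|^2]. *)
- eexists; last exact: (box_int_energy hab hkappa hmu hsol tT h123 h45).
  have Cu l := time_C1_u hsol l.
  have := has_dtZ (c := 2^-1) (has_dt_box_int (a := a) (b := b) (time_C1M (time_C1_rho hsol)
    (time_C1_sum (index_enum 'I_d) (fun l => time_C1M (Cu l) (Cu l)))) tT).
  exact.
- apply: has_dt_row => j; rewrite mxE -(box_int_dm hab hkappa hmu hsol tT j h13 h54).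
  under [X in has_dt _ X]eq_fun do rewrite mxE.
  exact: has_dt_box_int (time_C1_momentum hsol j) tT.
- apply: has_dt_row => k; rewrite mxE.
  have [[j [l [jl cE]]]|c0] := cross_component R d k; last first.
    have E : (fun s => angular_momentum a b rho u s 0 k) = fun=> box_int a b (cst 0).
      by apply/funext => s; rewrite mxE; apply: eq_box_int => x _; exact: c0.
    rewrite E -[X in has_dt _ _ _ X](box_int0 a b).
    exact: (has_dt_box_int (a := a) (b := b) (time_C1_cst T 0) tT).
  have E : (fun s => angular_momentum a b rho u s 0 k) = fun s => box_int a b (fun x =>
      momentum rho u s x 0 j * x 0 l - momentum rho u s x 0 l * x 0 j).
    by apply/funext => s; rewrite mxE; apply: eq_box_int => x _; exact: cE.
  rewrite E -(box_int_dm_moment hab hkappa hmu hsol tT h13 h54 h24 jl (noflux t tT)).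
  (* Positions enter as factors independent of time; their zero derivative leaves the terms erased
     by [mulr0] at the end. *)
  have C j' l' := time_C1M (time_C1_momentum hsol j')
    (time_C1_space T (@coord_continuous R 1 d 0 l')).
  have := has_dt_box_int (a := a) (b := b) (time_C1B (C j l) (C l j)) tT.
  congr has_dt; apply: eq_box_int => x _.
  by rewrite !mulr0 !addr0.
Qed.
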